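(* Let $A$ be an Artin algebra with $\mathrm{id}(A)<\infty$. Then $$\mathrm{findim}(A)\le \phi\dim(A)\le\psi\dim(A)\le \mathrm{id}(A)\le\mathrm{dell}(A)\le\mathrm{Dell}(A).$$
   Context: Modules are right modules; $\mathrm{mod}\,A$ is the category of finitely generated right $A$-modules and $\underline{\mathrm{mod}}\,A$ its stable category (modulo projectives). $\mathrm{id}(A)$ denotes the injective dimension of the right module $A_A$. $\Omega(M)$ is the syzygy of $M$ (kernel of a projective cover), $\Omega^0(M)=M$, $\Omega^{n+1}(M)=\Omega(\Omega^n(M))$. $\mathrm{findim}(A)=\sup\{\mathrm{pd}(M):M\in\mathrm{mod}\,A,\ \mathrm{pd}(M)<\infty\}$. For $M\in\mathrm{mod}\,A$, $\mathrm{dell}(M)=\inf\{n\ge 0:\Omega^n(M)$ is a direct summand of $\Omega^{n+1}(N)$ in $\underline{\mathrm{mod}}\,A$ for some $N\in\mathrm{mod}\,A\}$, with $\mathrm{dell}(M)=\infty$ if no such $n$ exists. $\mathrm{dell}(A)=\sup\{\mathrm{dell}(S): S \text{ a simple } A\text{-module}\}$ and $\mathrm{Dell}(A)=\sup\{\mathrm{dell}(M): M\in\mathrm{mod}\,A\}$ (two different invariants). $K_0(A)$ is the quotient of the free abelian group on symbols $[M]$, one for each isomorphism class of modules $M\in\mathrm{mod}\,A$, by the relations $[M]-[M']-[M'']$ whenever $M\cong M'\oplus M''$, and $[P]$ for each projective $P$. $\bar\Omega:K_0(A)\to K_0(A)$ is the endomorphism with $\bar\Omega([M])=[\Omega(M)]$.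 For $M\in\mathrm{mod}\,A$, $\langle\mathrm{add}\,M\rangle\subset K_0(A)$ is the subgroup generated by the classes of indecomposable direct summands of $M$. The Igusa–Todorov functions are: $\phi(M)$, the smallest $n\ge0$ such that $\bar\Omega:\bar\Omega^{m}(\langle\mathrm{add}\,M\rangle)\to\bar\Omega^{m+1}(\langle\mathrm{add}\,M\rangle)$ is an isomorphism for all $m\ge n$; and $\psi(M)=\phi(M)+\sup\{\mathrm{pd}(N): N \text{ a direct summand of }\Omega^{\phi(M)}(M),\ \mathrm{pd}(N)<\infty\}$. $\phi\dim(A)$ and $\psi\dim(A)$ are the suprema of $\phi$ and $\psi$ over $\mathrm{mod}\,A$. *)

(* Defs.v *)
From HB Require Import structures.
From mathcomp Require Import all_boot all_order all_algebra.
From mathcomp Require Import boolp.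

Set Implicit Arguments.
Unset Strict Implicit.
Unset Printing Implicit Defensive.

Import GRing.Theory.
Local Open Scope ring_scope.

Variant enat := Fin of nat | Infty.

Definition enat_le (x y : enat) : bool :=
  match x, y with
  | _, Infty => true
  | Infty, Fin _ => false
  | Fin m, Fin n => (m <= n)%N
  end.

Definition enat_add (x y : enat) : enat :=
  match x, y with
  | Fin m, Fin n => Fin (m + n)
  | _, _ => Infty
  end.

Declare Scope enat_scope.
Delimit Scope enat_scope with enat.
Bind Scope enat_scope with enat.
Notation "x <= y" := (enat_le x y) : enat_scope.
Notation "x + y" := (enat_add x y) : enat_scope.

Lemma asbool_ex (P : nat -> Prop) : (exists n, P n) -> exists n, `[< P n >].
Proof. by case=> n Pn; exists n; apply/asboolP. Qed.

(* Least natural number satisfying P; the infimum of the empty set is Infty. *)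
Definition enat_inf (P : nat -> Prop) : enat :=
  match pselect (exists n, P n) with
  | left exP => Fin (ex_minn (asbool_ex exP))
  | right _ => Infty
  end.

(* Least upper bound in {0, 1, ..., Infty}; the supremum of the empty set
   is 0. *)
Definition enat_sup (X : enat -> Prop) : enat :=
  enat_inf (fun n => forall x, X x -> (x <= Fin n)%enat).

Section Modules.
Variable S : pzRingType.
Implicit Types K M N P I : lmodType S.

Definition finitely_generated M : Prop :=
  exists (n : nat) (e : 'I_n -> M),
    forall x, exists a : 'I_n -> S, x = \sum_(i < n) a i *: e i.

Definition is_submodule M (U : M -> Prop) : Prop :=
  U 0 /\ forall (a : S) (x y : M), U x -> U y -> U (a *: x + y).

Definition artinian_module M : Prop :=
  forall U : nat -> M -> Prop,
    (forall n, is_submodule (U n)) ->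
    (forall n x, U n.+1 x -> U n x) ->
    exists n, forall m, (n <= m)%N -> forall x, U m x <-> U n x.

Definition isomorphic M N : Prop := exists f : {linear M -> N}, bijective f.

Definition is_zero M : Prop := forall x : M, x = 0.

Definition simple_module M : Prop :=
  ~ is_zero M /\
  forall U : M -> Prop, is_submodule U ->
    (forall x, U x -> x = 0) \/ (forall x, U x).

Definition is_summand N M : Prop :=
  exists L : lmodType S, isomorphic M (N * L)%type.

Definition indecomposable M : Prop :=
  ~ is_zero M /\
  forall X Y : lmodType S, isomorphic M (X * Y)%type -> is_zero X \/ is_zero Y.

Definition surjective M N (f : M -> N) : Prop := forall y, exists x, f x = y.

Definition exact_at M N P (f : {linear M -> N}) (g : {linear N -> P}) : Prop :=
  forall y, g y = 0 <-> exists x, f x = y.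

Definition projective P : Prop :=
  forall (M N : lmodType S) (g : {linear M -> N}) (f : {linear P -> N}),
    surjective g -> exists h : {linear P -> M}, forall x, g (h x) = f x.

Definition injective_module I : Prop :=
  forall (M N : lmodType S) (g : {linear M -> N}) (f : {linear M -> I}),
    injective g -> exists h : {linear N -> I}, forall x, h (g x) = f x.

(* An exact sequence 0 -> P_n -> ... -> P_0 -> M -> 0, extended by zero. *)
Definition has_projective_resolution M (n : nat) : Prop :=
  exists (P : nat -> lmodType S) (d : forall i, {linear P i.+1 -> P i})
         (e : {linear P 0%N -> M}),
    [/\ forall i, projective (P i),
        surjective e,
        exact_at (d 0%N) e,
        forall i, exact_at (d i.+1) (d i) &
        forall i, (n < i)%N -> is_zero (P i)].

(* An exact sequence 0 -> M -> I_0 -> ... -> I_n -> 0, extended by zero. *)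
Definition has_injective_resolution M (n : nat) : Prop :=
  exists (I : nat -> lmodType S) (d : forall i, {linear I i -> I i.+1})
         (e : {linear M -> I 0%N}),
    [/\ forall i, injective_module (I i),
        injective e,
        exact_at e (d 0%N),
        forall i, exact_at (d i) (d i.+1) &
        forall i, (n < i)%N -> is_zero (I i)].

Definition pd M : enat := enat_inf (has_projective_resolution M).

Definition injdim M : enat := enat_inf (has_injective_resolution M).

Definition superfluous M (L : M -> Prop) : Prop :=
  forall U : M -> Prop, is_submodule U ->
    (forall x, exists u k, [/\ U u, L k & x = u + k]) -> forall x, U x.

Definition projective_cover P M (f : {linear P -> M}) : Prop :=
  [/\ projective P, surjective f & superfluous (fun x => f x = 0)].

Definition is_syzygy K M : Prop :=
  exists (P : lmodType S) (i : {linear K -> P}) (f : {linear P -> M}),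
    [/\ projective_cover f, injective i & exact_at i f].

End Modules.

(* A right A-module is a left module over the opposite ring A^c, where
   a *: x stands for x a; in particular (A^c)^o is A as a right module over
   itself. *)
Notation rmodType A := (lmodType A^c).

Definition artin_algebra (R : comNzRingType) (A : algType R) : Prop :=
  artinian_module (R^o : lmodType R) /\ finitely_generated (A : lmodType R).

Record fgmod (A : pzRingType) := FgMod {
  fgmod_sort :> rmodType A;
  fgmod_fg : finitely_generated fgmod_sort
}.

Section Syzygy.
Variable A : pzRingType.
Implicit Types M N X Y : fgmod A.

(* The kernel of a projective cover is only determined up to isomorphism, so
   one is chosen. Over an Artin algebra every finitely generated module has a
   projective cover with finitely generated kernel, and the default value M is
   never used. *)
Definition Omega M : fgmod A :=
  match pselect (exists K : fgmod A, is_syzygy K M) with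
  | left exK => sval (cid exK)
  | right _ => M
  end.

(* Equality of morphisms in the stable category: the difference factors
   through a projective module. *)
Definition stable_eq (U V : rmodType A) (f g : U -> V) : Prop :=
  exists (P : fgmod A) (a : {linear U -> P}) (b : {linear P -> V}),
    projective P /\ forall x, f x - g x = b (a x).

Definition stable_iso (U V : rmodType A) : Prop :=
  exists (f : {linear U -> V}) (g : {linear V -> U}),
    stable_eq (g \o f) (fun x => x) /\ stable_eq (f \o g) (fun y => y).

Definition stable_summand X Y : Prop :=
  exists Z : fgmod A, stable_iso Y (X * Z)%type.

Definition dell M : enat :=
  enat_inf (fun n => exists N : fgmod A,
    stable_summand (iter n Omega M) (iter n.+1 Omega N)).

End Syzygy.

Section GrothendieckGroup.
Variable A : pzRingType.

(* K_0(A) is presented by generators and relations: its elements are the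
   formal expressions below, and equality in K_0(A) is the congruence K0_eq. *)
Inductive K0 : Type :=
  | K0_class of fgmod A
  | K0_zero
  | K0_opp of K0
  | K0_add of K0 & K0.

Inductive K0_eq : K0 -> K0 -> Prop :=
  | K0_refl x : K0_eq x x
  | K0_sym x y : K0_eq x y -> K0_eq y x
  | K0_trans x y z : K0_eq x y -> K0_eq y z -> K0_eq x z
  | K0_opp_congr x y : K0_eq x y -> K0_eq (K0_opp x) (K0_opp y)
  | K0_add_congr x x' y y' :
      K0_eq x x' -> K0_eq y y' -> K0_eq (K0_add x y) (K0_add x' y')
  | K0_addA x y z : K0_eq (K0_add x (K0_add y z)) (K0_add (K0_add x y) z)
  | K0_addC x y : K0_eq (K0_add x y) (K0_add y x)
  | K0_add0 x : K0_eq (K0_add K0_zero x) x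
  | K0_addN x : K0_eq (K0_add (K0_opp x) x) K0_zero
  | K0_iso (M N : fgmod A) :
      isomorphic M N -> K0_eq (K0_class M) (K0_class N)
  | K0_sum (M M' M'' : fgmod A) :
      isomorphic M (M' * M'')%type ->
      K0_eq (K0_class M) (K0_add (K0_class M') (K0_class M''))
  | K0_proj (P : fgmod A) : projective P -> K0_eq (K0_class P) K0_zero.

Fixpoint K0_Omega (x : K0) : K0 :=
  match x with
  | K0_class M => K0_class (Omega M)
  | K0_zero => K0_zero
  | K0_opp x => K0_opp (K0_Omega x)
  | K0_add x y => K0_add (K0_Omega x) (K0_Omega y)
  end.

Inductive add_subgroup (M : fgmod A) : K0 -> Prop :=
  | add_subgroup_class (X : fgmod A) :
      indecomposable X -> is_summand X M -> add_subgroup M (K0_class X)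
  | add_subgroup_zero : add_subgroup M K0_zero
  | add_subgroup_opp x : add_subgroup M x -> add_subgroup M (K0_opp x)
  | add_subgroup_add x y :
      add_subgroup M x -> add_subgroup M y -> add_subgroup M (K0_add x y)
  | add_subgroup_eq x y : K0_eq x y -> add_subgroup M x -> add_subgroup M y.

Definition K0_Omega_image (m : nat) (M : fgmod A) (x : K0) : Prop :=
  exists y, add_subgroup M y /\ K0_eq x (iter m K0_Omega y).

Definition K0_Omega_iso_on (H H' : K0 -> Prop) : Prop :=
  [/\ forall x, H x -> H' (K0_Omega x),
      forall x y, H x -> H y -> K0_eq (K0_Omega x) (K0_Omega y) -> K0_eq x y &
      forall z, H' z -> exists x, H x /\ K0_eq (K0_Omega x) z].

Definition phi (M : fgmod A) : enat :=
  enat_inf (fun n => forall m, (n <= m)%N ->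
    K0_Omega_iso_on (K0_Omega_image m M) (K0_Omega_image m.+1 M)).

Definition psi (M : fgmod A) : enat :=
  match phi M with
  | Fin n => (Fin n + enat_sup (fun x => exists N : fgmod A,
      [/\ is_summand N (iter n (@Omega A) M), pd N <> Infty & x = pd N]))%enat
  | Infty => Infty
  end.

End GrothendieckGroup.

Section AlgebraInvariants.
Variable A : pzRingType.

Definition findim : enat :=
  enat_sup (fun x => exists M : fgmod A, pd M <> Infty /\ x = pd M).

Definition phidim : enat := enat_sup (fun x => exists M : fgmod A, x = phi M).

Definition psidim : enat := enat_sup (fun x => exists M : fgmod A, x = psi M).

Definition id_alg : enat := injdim ((A^c)^o : rmodType A).

Definition dell_alg : enat :=
  enat_sup (fun x => exists M : fgmod A, simple_module M /\ x = dell M).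

Definition Dell_alg : enat := enat_sup (fun x => exists M : fgmod A, x = dell M).

End AlgebraInvariants.

(* Main.v *)
Require Import Defs.
From HB Require Import structures.
From mathcomp Require Import all_boot all_order all_algebra.
From mathcomp Require Import boolp classical_sets ring_quotient generic_quotient.
From Stdlib Require Import Setoid Morphisms.

(** The second inequality is the definition of psi, and the last compares a supremum
    over the simple modules with one over all modules.  For the first, if
    pd M = n + 1, then the class of Omega^n M is nonzero in K0 because Omega^n M is
    not projective, whereas its image is the class of a projective module; so the
    endomorphism of K0 is not yet injective at stage n, and pd M <= phi M
    (pd_le_phi).

    Let d be the injective dimension of A.  The other two come from dimension
    shifting: Ext^1(Omega^m M, A) = Ext^(m+1)(M, A) vanishes for m >= d
    (ext1_Omega).

    - When Ext^1(X, A) = Ext^1(Y, A) = 0, the syzygies of X and Y determine X and Y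
      up to projective summands (dual_schanuel).  Hence the endomorphism of K0 is
      injective from stage d on, and phi M <= d (phi_stable).  If N is a summand of
      Omega^n M with n = phi M and pd N = k >= 1, then n + k <= d: otherwise
      Ext^1(Omega^(k-1) N, -) vanishes on projectives, the presentation of
      Omega^(k-1) N by a projective with projective kernel Omega^k N splits, and
      pd N < k (pd_summand_bound).  Thus psi M <= d.

    - Suppose d >= 1 and dell T <= d - 1 for all simple T.  Then Omega^(d-1) T is a
      stable summand of Omega^d N for some N, and Ext^d(T, A) is a summand of
      Ext^(d+1)(N, A) = 0.  A module is injective as soon as its Ext^1 vanishes on
      simple modules (injective_of_simple), and applying this to a cosyzygy of A
      gives injective dimension at most d - 1: a contradiction
      (injdim_le_of_dell).

    Both parts rest on the structure of finitely generated modules over A.  They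
    satisfy both chain conditions, because the artinian ring R is noetherian
    (commutative_hopkins) and A is finitely generated over it.  So projective covers
    exist (syzygy_exists), and finitely generated summands can be cancelled
    (cancellation), which turns an equality of classes in K0 into an isomorphism up
    to projective summands (K0_rel_sound, K0_class_eq).

    Ext is never constructed: only the vanishing of Ext^1 is used, in the form of an
    extension property for maps out of a syzygy (ext1_zero), and higher degrees are
    reached by replacing a module by its syzygies. *)

Set Implicit Arguments.
Unset Strict Implicit.
Unset Printing Implicit Defensive.

Import GRing.Theory.
Local Open Scope ring_scope.

(** * Submodules and linear maps *)

Section Submodules.
Variable S : pzRingType.
Implicit Types K M N P X Y C : lmodType S.

Section Closure.
Variables (M : lmodType S) (U : M -> Prop) (hU : is_submodule U).

Lemma submodule0 : U 0. Proof. by case: hU. Qed.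

Lemma submoduleZ a x : U x -> U (a *: x).
Proof. by move=> Ux; rewrite -[_ *: _]addr0; apply: (proj2 hU) => //; apply: submodule0. Qed.

Lemma submoduleD x y : U x -> U y -> U (x + y).
Proof. by move=> Ux Uy; rewrite -[x]scale1r; apply: (proj2 hU). Qed.

Lemma submoduleN x : U x -> U (- x).
Proof. by rewrite -scaleN1r; apply: submoduleZ. Qed.

Lemma submoduleB x y : U x -> U y -> U (x - y).
Proof. by move=> Ux Uy; apply: submoduleD => //; apply: submoduleN. Qed.

End Closure.

Lemma submodule_cap M (U V : M -> Prop) :
  is_submodule U -> is_submodule V -> is_submodule (fun x => U x /\ V x).
Proof.
move=> hU hV; split; first by split; apply: submodule0.
by move=> a x y [? ?] [? ?]; split; [apply: (proj2 hU) | apply: (proj2 hV)].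
Qed.

Lemma submodule_sum M (U V : M -> Prop) :
  is_submodule U -> is_submodule V ->
  is_submodule (fun x => exists u v, [/\ U u, V v & x = u + v]).
Proof.
move=> hU hV; split; first by exists 0, 0; split; rewrite ?addr0 //; apply: submodule0.
move=> a _ _ [u [v [Uu Vv ->]]] [u' [v' [Uu' Vv' ->]]].
exists (a *: u + u'), (a *: v + v'); split.
- exact: (proj2 hU).
- exact: (proj2 hV).
- by rewrite scalerDr addrACA.
Qed.

Lemma submodule_zero M : is_submodule (fun x : M => x = 0).
Proof. by split=> // a x y -> ->; rewrite scaler0 addr0. Qed.

Lemma submodule_all M : is_submodule (fun _ : M => True).
Proof. by []. Qed.

Lemma submodule_im M N (f : {linear M -> N}) (U : M -> Prop) :
  is_submodule U -> is_submodule (fun y => exists2 x, U x & f x = y).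
Proof.
move=> hU; split; first by exists 0; [apply: submodule0 | rewrite linear0].
move=> a _ _ [x Ux <-] [y Uy <-]; exists (a *: x + y); last by rewrite linearP.
exact: (proj2 hU).
Qed.

Lemma submodule_preim M N (f : {linear M -> N}) (V : N -> Prop) :
  is_submodule V -> is_submodule (fun x => V (f x)).
Proof.
move=> hV; split; first by rewrite linear0; apply: submodule0.
by move=> a x y Vx Vy; rewrite linearP; apply: (proj2 hV).
Qed.

Lemma submodule_line M (x : M) : is_submodule (fun y => exists a, y = a *: x).
Proof.
split; first by exists 0; rewrite scale0r.
by move=> a _ _ [b ->] [c ->]; exists (a * b + c); rewrite scalerDl scalerA.
Qed.

Lemma linear_map M N (f : M -> N) :
  linear f -> exists g : {linear M -> N}, g =1 f.
Proof.
move=> lf.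
pose mix := GRing.isLinear.Build S M N *:%R f lf.
pose g : {linear M -> N} := HB.pack f mix.
by exists g.
Qed.

(** Most linear maps below arise from a relation rather than from a formula:
    factorisations, inverses, glued extensions.  A total relation that is a
    submodule of the product and relates 0 only to 0 is the graph of a linear map. *)
Lemma graph_linear M N (G : M * N -> Prop) :
  is_submodule G -> (forall x, exists y, G (x, y)) ->
  (forall y, G (0, y) -> y = 0) ->
  exists h : {linear M -> N}, forall x, G (x, h x).
Proof.
move=> hG Gtot G0; pose h x := sval (cid (Gtot x)).
have hP x : G (x, h x) by rewrite /h; case: cid.
have [|g gE] := @linear_map M N h; last by exists g => x; rewrite gE.
move=> a x y; apply/eqP; rewrite -subr_eq0; apply/eqP/G0.
have := submoduleB hG (hP (a *: x + y)) (proj2 hG a _ _ (hP x) (hP y)).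
by congr G; congr (_, _); apply: subrr.
Qed.

Definition bij_map M N (f : M -> N) : Prop := injective f /\ surjective f.

Lemma linear_inj M N (f : {linear M -> N}) :
  (forall x, f x = 0 -> x = 0) -> injective f.
Proof.
move=> f0 x y fxy; apply/eqP; rewrite -subr_eq0; apply/eqP/f0.
by rewrite linearB fxy subrr.
Qed.

Lemma linear_inv M N (f : {linear M -> N}) : bij_map f ->
  exists g : {linear N -> M}, cancel f g /\ cancel g f.
Proof.
move=> [fi fs].
have [] := @graph_linear N M (fun w => f w.2 = w.1).
- split; first by rewrite /= linear0.
  by move=> a x y /= <- <-; rewrite linearP.
- by move=> y; have [x <-] := fs y; exists x.
- by move=> x /= fx0; apply: fi; rewrite linear0.
by move=> g /= gE; exists g; split=> // x; apply: fi; rewrite gE.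
Qed.

Lemma bij_iso M N (f : {linear M -> N}) : bij_map f -> isomorphic M N.
Proof. by move=> /linear_inv[g [? ?]]; exists f; exists g. Qed.

Lemma iso_linear M N : isomorphic M N ->
  exists (f : {linear M -> N}) (g : {linear N -> M}), cancel f g /\ cancel g f.
Proof.
case=> f fb; have [g fg gf] := fb; exists f; apply: linear_inv.
by split; [apply: (can_inj fg) | move=> y; exists (g y)].
Qed.

Lemma factor_surj M N C (p : {linear M -> N}) (h : {linear M -> C}) :
  surjective p -> (forall x, p x = 0 -> h x = 0) ->
  exists k : {linear N -> C}, forall x, k (p x) = h x.
Proof.
move=> ps kp.
have [] := @graph_linear N C (fun w => exists x, p x = w.1 /\ h x = w.2).
- split; first by exists 0; rewrite !linear0.
  move=> a _ _ /= [x [<- <-]] [y [<- <-]]; exists (a *: x + y).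
  by rewrite !linearP.
- by move=> y; have [x <-] := ps y; exists (h x), x.
- by move=> c /= [x [/kp <- <-]].
move=> k kE; exists k => x; have /= [y [pyx <-]] := kE (p x).
apply/esym/eqP; rewrite -subr_eq0 -linearB; apply/eqP/kp.
by rewrite linearB pyx subrr.
Qed.

Lemma factor_inj M N C (i : {linear M -> N}) (h : {linear C -> N}) :
  injective i -> (forall x, exists y, i y = h x) ->
  exists k : {linear C -> M}, forall x, i (k x) = h x.
Proof.
move=> ii hi.
have [] := @graph_linear C M (fun w => i w.2 = h w.1) => //=.
- split; first by rewrite /= !linear0.
  by move=> a x y /=; rewrite !linearP => -> ->.
- by move=> y; rewrite linear0 => iy; apply: ii; rewrite linear0.
by move=> k kE; exists k.
Qed.

(** Used instead of a cokernel: both targets are the quotient by the common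
    kernel, so no quotient has to be formed. *)
Lemma same_kernel_iso M N C (p : {linear M -> N}) (q : {linear M -> C}) :
  surjective p -> surjective q -> (forall x, p x = 0 <-> q x = 0) ->
  isomorphic N C.
Proof.
move=> ps qs pq; have [k kE] := factor_surj ps (fun x => proj1 (pq x)).
apply: (@bij_iso _ _ k); split.
  apply: linear_inj => y; have [x <-] := ps y; by rewrite kE => /pq.
by move=> c; have [x <-] := qs c; exists (p x); rewrite kE.
Qed.

Definition sub_pred M (U : M -> Prop) (hU : is_submodule U) : {pred M} :=
  fun x => `[< U x >].

Definition submod M (U : M -> Prop) (hU : is_submodule U) : Type :=
  {x : M | x \in sub_pred hU}.

End Submodules.

Section SubmodInstance.
Variables (S : pzRingType) (M : lmodType S) (U : M -> Prop).
Variable hU : is_submodule U.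

Fact sub_pred_closed : submod_closed (sub_pred hU).
Proof.
split; first by apply/asboolP; apply: submodule0.
by move=> a x y /asboolP Ux /asboolP Uy; apply/asboolP/(proj2 hU).
Qed.

HB.instance Definition _ := GRing.isSubmodClosed.Build S M (sub_pred hU)
  sub_pred_closed.
HB.instance Definition _ := SubChoice.on (submod hU).
HB.instance Definition _ := [SubChoice_isSubLmodule of submod hU by <:].

Definition sub_incl : {linear submod hU -> M} := val : {linear submod hU -> M}.

Lemma sub_incl_inj : injective sub_incl.
Proof. exact: val_inj. Qed.

Lemma sub_inclP x : U (sub_incl x).
Proof. by apply/asboolP; apply: (valP x). Qed.

Lemma sub_incl_onto x : U x -> exists y, sub_incl y = x.
Proof. by move=> /asboolP Ux; exists (exist _ x Ux). Qed.

Lemma sub_corestr (N : lmodType S) (f : {linear N -> M}) : (forall x, U (f x)) ->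
  exists g : {linear N -> submod hU}, forall x, sub_incl (g x) = f x.
Proof. by move=> fU; apply: factor_inj sub_incl_inj _ => x; apply: sub_incl_onto. Qed.

End SubmodInstance.

(** * Quotient modules *)

Section QuotientModule.
Variables (S : pzRingType) (M : lmodType S) (U : M -> Prop).
Variable hU : is_submodule U.

Definition quotmod : Type := Quotient.quot (sub_pred hU).

HB.instance Definition _ := GRing.Zmodule.on quotmod.

Let pi (x : M) : quotmod := (\pi_(Quotient.quot (sub_pred hU)) x)%qT.
Let rep (x : quotmod) : M := repr x.

Let pi_eq x y : pi x = pi y <-> U (x - y).
Proof.
rewrite /pi; split.
  by move/eqP; rewrite -Quotient.idealrBE => /asboolP.
by move=> Uxy; apply/eqP; rewrite -Quotient.idealrBE; apply/asboolP.
Qed.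

Let repK x : pi (rep x) = x. Proof. exact: reprK. Qed.

Let piD x y : pi (x + y) = pi x + pi y.
Proof. exact: (Quotient.pi_add (sub_pred hU) x y). Qed.

Definition quot_scale (a : S) (x : quotmod) : quotmod := pi (a *: rep x).

Let piZ a x : pi (a *: x) = quot_scale a (pi x).
Proof. by apply/pi_eq; rewrite -scalerBr; apply: submoduleZ => //; apply/pi_eq; rewrite repK. Qed.

Fact quot_scaleA a b x : quot_scale a (quot_scale b x) = quot_scale (a * b) x.
Proof. by rewrite -[x]repK -!piZ scalerA. Qed.
Fact quot_scale1 : left_id 1 quot_scale.
Proof. by move=> x; rewrite -[x]repK -!piZ scale1r. Qed.
Fact quot_scaleDr : right_distributive quot_scale +%R.
Proof. by move=> a x y; rewrite -[x]repK -[y]repK -!(piD, piZ) scalerDr. Qed.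
Fact quot_scaleDl x : {morph quot_scale^~ x : a b / a + b}.
Proof. by move=> a b; rewrite -[x]repK -!piZ -piD scalerDl. Qed.

HB.instance Definition _ := GRing.Zmodule_isLmodule.Build S quotmod
  quot_scaleA quot_scale1 quot_scaleDr quot_scaleDl.

Lemma quot_proj : exists p : {linear M -> quotmod},
  surjective p /\ forall x, p x = 0 <-> U x.
Proof.
have [|p pE] := @linear_map S M quotmod pi.
  by move=> a x y; rewrite piD piZ.
exists p; split; first by move=> x; exists (rep x); rewrite pE repK.
move=> x; have <- : p 0 = 0 by rewrite linear0.
by rewrite !pE pi_eq subr0.
Qed.

End QuotientModule.

(** * Chain conditions *)

Section ChainConditions.
Variable S : pzRingType.
Implicit Types M N : lmodType S.

Definition strict_sub M (V U : M -> Prop) : Prop :=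
  [/\ is_submodule V, (forall x, V x -> U x) & exists2 x, U x & ~ V x].

(** A descending sequence without a last strict inclusion would be extracted by
    choice from a submodule that is not accessible. *)
Lemma artinian_wf M : artinian_module M -> well_founded (@strict_sub M).
Proof.
move=> art U; apply/not_notP => nU.
pose bad := {V : M -> Prop | ~ Acc (@strict_sub M) V}.
have step (V : bad) : exists W : bad, strict_sub (sval W) (sval V).
  case: V => V nV /=; apply/not_notP => nW; apply: nV; split=> W WV.
  by apply/not_notP => nAW; apply: nW; exists (exist _ W nAW).
pose nxt V := sval (cid (step V)).
have nxtP V : strict_sub (sval (nxt V)) (sval V) by rewrite /nxt; case: cid.
pose c n := sval (iter n.+1 nxt (exist _ U nU)).
have [n hn] := art c (fun n => let: And3 h _ _ := nxtP (iter n nxt (exist _ U nU)) in h)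
  (fun n => let: And3 _ h _ := nxtP (iter n.+1 nxt (exist _ U nU)) in h).
have [_ _ [x Ux]] := nxtP (iter n.+1 nxt (exist _ U nU)).
by apply; apply/(hn n.+1 (leqnSn n)).
Qed.

Lemma artinian_min M (B : (M -> Prop) -> Prop) (U : M -> Prop) :
  artinian_module M -> is_submodule U -> B U ->
  exists V, [/\ is_submodule V, B V & forall W, strict_sub W V -> ~ B W].
Proof.
move=> art; elim/(well_founded_ind (artinian_wf art)): U => U IH hU BU.
have [[W [WU BW]]|nW] := pselect (exists W, strict_sub W U /\ B W).
  by apply: (IH W) => //; case: WU.
by exists U; split=> // W WU BW; apply: nW; exists W.
Qed.

(** Zorn's lemma for submodules constrained by a property of their elements; such
    a constraint passes to unions of chains.  It serves twice: to find a submodule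
    maximal among those avoiding an element, and a maximal partial extension of a
    linear map, seen as a graph on which (0, c) forces c = 0. *)
Lemma zorn_submodule M (Q : M -> Prop) (U0 : M -> Prop) :
  is_submodule U0 -> (forall x, U0 x -> Q x) ->
  exists U, [/\ is_submodule U, forall x, U0 x -> U x, forall x, U x -> Q x &
    forall V, is_submodule V -> (forall x, U x -> V x) -> (forall x, V x -> Q x) ->
      forall x, V x -> U x].
Proof.
move=> hU0 Q0.
pose good (V : M -> Prop) :=
  [/\ is_submodule V, forall x, U0 x -> V x & forall x, V x -> Q x].
(* The empty chain has union set0, which is not a submodule; allowing it is
   harmless, since U0 is larger. *)
pose P (V : set M) := V = set0 \/ good V.
have [|U [PU Umax]] := @Zorn_bigcup M P.
  move=> F FP Ftot.
  have [[W [FW [w Ww]]]|nF] := pselect (exists W, F W /\ exists w : M, W w); last first.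
    left; apply/seteqP; split=> // x [W FW Wx].
    by apply: nF; exists W; split=> //; exists x.
  have Fgood V (x : M) : F V -> V x -> good V.
    by move=> FV Vx; have [V0|//] := FP V FV; rewrite V0 in Vx.
  have [hW UW _] := Fgood W w FW Ww.
  right; split; last first.
  - by move=> x [V FV Vx]; have [_ _] := Fgood V x FV Vx; apply.
  - by move=> x /UW Wx; exists W.
  split; first by exists W => //; apply: submodule0.
  move=> a x y [V FV Vx] [V' FV' Vy].
  have [hV _ _] := Fgood V x FV Vx; have [hV' _ _] := Fgood V' y FV' Vy.
  have [VV'|V'V] := Ftot V V' FV FV'.
    by exists V' => //; apply: (proj2 hV') => //; apply: VV'.
  by exists V => //; apply: (proj2 hV) => //; apply: V'V.
case: PU => [U0E|[hU U0U UQ]].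
  have : (set0 `<` U0)%classic.
    by split=> // h; have := h 0 (submodule0 hU0).
  by rewrite -U0E => /Umax []; right.
exists U; split=> // V hV UV VQ x Vx; apply/not_notP => nUx.
apply: (Umax V); first by split=> // /(_ x Vx).
by right; split=> // y /U0U /UV.
Qed.

(** Recursion on the generators, so that finite generation can be proved by adding
    one generator at a time; span_sum relates it to linear combinations. *)
Fixpoint span M (s : seq M) (x : M) : Prop :=
  if s is e :: s' then exists a : S, span s' (x - a *: e) else x = 0.

Lemma submodule_span M (s : seq M) : is_submodule (span s).
Proof.
elim: s => [|e s IH] /=; first exact: submodule_zero.
split; first by exists 0; rewrite scale0r subr0; apply: submodule0.
move=> a x y [b hb] [c hc]; exists (a * b + c).
rewrite scalerDl opprD addrACA -scalerA -scalerBr.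
exact: (proj2 IH).
Qed.

Lemma span_min M (s : seq M) (U : M -> Prop) : is_submodule U ->
  (forall i, (i < size s)%N -> U s`_i) -> forall x, span s x -> U x.
Proof.
move=> hU; elim: s => [|e s IH] /= Us x; first by move=> ->; apply: submodule0.
case=> a /IH Ux; rewrite -[x](subrK (a *: e)); apply: submoduleD => //.
  by apply: Ux => i; apply: (Us i.+1).
by apply: submoduleZ => //; apply: (Us 0%N).
Qed.

Lemma span_mem M (s : seq M) i : (i < size s)%N -> span s s`_i.
Proof.
elim: s i => [//|e s IH] [|i] /= hi.
  by exists 1; rewrite scale1r subrr; apply: submodule0; apply: submodule_span.
by exists 0; rewrite scale0r subr0; apply: IH.
Qed.

Lemma span_sum M (s : seq M) x :
  span s x <-> exists a : 'I_(size s) -> S, x = \sum_i a i *: s`_i.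
Proof.
split; last first.
  case=> a ->; elim/big_ind: _.
  - by apply: submodule0; apply: submodule_span.
  - by move=> y z; apply: submoduleD; apply: submodule_span.
  by move=> i _; apply: submoduleZ; [apply: submodule_span | apply: span_mem].
elim: s x => [|e s IH] x /=.
  by move=> ->; exists (fun=> 0); rewrite big_ord0.
case=> b /IH[a xE].
exists (fun i => if unlift ord0 i is Some j then a j else b).
rewrite big_ord_recl /= unlift_none -[x](subrK (b *: e)) xE addrC.
by congr (_ + _); apply: eq_bigr => i _; rewrite liftK.
Qed.

Lemma fg_span M : finitely_generated M <-> exists s : seq M, forall x, span s x.
Proof.
split=> [[n [e eP]]|[s sP]].
  exists (codom e) => x; have [a ->] := eP x; elim/big_ind: _.
  - by apply: submodule0; apply: submodule_span.
  - by move=> y z; apply: submoduleD; apply: submodule_span.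
  move=> i _; apply: submoduleZ; first exact: submodule_span.
  have -> : e i = (codom e)`_i.
    by rewrite (nth_map i) ?nth_ord_enum ?size_enum_ord.
  by apply: span_mem; rewrite size_codom card_ord.
by exists (size s), (fun i => s`_i) => x; apply/span_sum.
Qed.

Definition fg_sub M (U : M -> Prop) : Prop :=
  exists s : seq M, forall x, U x <-> span s x.

Definition noetherian_sub M (U : M -> Prop) : Prop :=
  forall V : M -> Prop, is_submodule V -> (forall x, V x -> U x) -> fg_sub V.

Definition noetherian M : Prop := noetherian_sub (fun _ : M => True).

Lemma span_cat M (s t : seq M) x :
  span (s ++ t) x <-> exists u v, [/\ span s u, span t v & x = u + v].
Proof.
elim: s x => [|e s IH] x /=.
  split; first by exists 0, x; rewrite add0r.
  by case=> u [v [-> ? ->]]; rewrite add0r.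
split.
  case=> a /IH [u [v [su tv xE]]]; exists (u + a *: e), v; split=> //.
    by exists a; rewrite addrK.
  by rewrite addrAC -xE subrK.
case=> u [v [[a su] tv ->]]; exists a; apply/IH; exists (u - a *: e), v.
by split=> //; rewrite addrAC.
Qed.

Lemma span_im M N (f : {linear M -> N}) (s : seq M) y :
  span (map f s) y <-> exists2 x, span s x & f x = y.
Proof.
elim: s y => [|e s IH] y /=.
  by split=> [->|[x -> <-]]; [exists 0; rewrite ?linear0 | rewrite linear0].
split.
  case=> a /IH[x sx fx]; exists (x + a *: e); first by exists a; rewrite addrK.
  by rewrite linearD linearZ /= fx subrK.
case=> x [a sx] <-; exists a; apply/IH; exists (x - a *: e) => //.
by rewrite linearB linearZ.
Qed.

Lemma lift_span M N (R : M -> N -> Prop) (t : seq N) :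
  (forall y, span t y -> exists x, R x y) ->
  exists s : seq M, size s = size t /\
    forall i, (i < size t)%N -> R s`_i t`_i.
Proof.
move=> H.
have {}H i : exists x, (i < size t)%N -> R x t`_i.
  have [it|] := boolP (i < size t)%N; last by exists 0.
  by have [x] := H _ (span_mem it); exists x.
pose x i := sval (cid (H i)).
have xP i : (i < size t)%N -> R (x i) t`_i by rewrite /x; case: cid.
exists (mkseq x (size t)); rewrite size_mkseq; split=> // i it.
by rewrite nth_mkseq //; apply: xP.
Qed.

(** Generators of the kernel part together with lifts of generators of the image. *)
Lemma fg_extension M N (f : {linear M -> N}) (V : M -> Prop) : is_submodule V ->
  fg_sub (fun x => V x /\ f x = 0) -> fg_sub (fun y => exists2 x, V x & f x = y) ->
  fg_sub V.
Proof.
move=> hV [s sE] [t tE].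
have [|r [rs rE]] := @lift_span M N (fun x y => V x /\ f x = y) t.
  by move=> y /tE[x]; exists x.
have fr : map f r = t.
  apply: (@eq_from_nth _ 0); rewrite size_map // => i ir.
  by rewrite (nth_map 0) //; apply: (proj2 (rE i _)); rewrite -rs.
exists (s ++ r) => x; rewrite span_cat; split.
  move=> Vx; have /tE : exists2 z, V z & f z = f x by exists x.
  rewrite -fr => /span_im[v rv fv]; exists (x - v), v; split; rewrite ?subrK //.
  apply/sE; split; last by rewrite linearB fv subrr.
  apply: submoduleB => //; apply: span_min rv => // i ir.
  by have [] := rE i; rewrite -?rs.
case=> u [v [/sE[Vu _] rv ->]]; apply: submoduleD => //.
by apply: span_min rv => // i ir; have [] := rE i; rewrite -?rs.
Qed.

Lemma noetherian_extension M N (f : {linear M -> N}) (U : M -> Prop) :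
  is_submodule U ->
  noetherian_sub (fun x => U x /\ f x = 0) ->
  noetherian_sub (fun y => exists2 x, U x & f x = y) -> noetherian_sub U.
Proof.
move=> hU nk ni V hV VU; apply: (fg_extension (f := f) hV).
  apply: nk => [|x [/VU]] //.
  exact: (submodule_cap hV (submodule_preim f (submodule_zero N))).
apply: ni; first exact: submodule_im.
by move=> y [x /VU]; exists x.
Qed.


Definition add_line M (U : M -> Prop) (x : M) : M -> Prop :=
  fun y => exists a : S, U (y - a *: x).

Lemma submodule_add_line M (U : M -> Prop) (x : M) : is_submodule U ->
  is_submodule (add_line U x).
Proof.
move=> hU; split; first by exists 0; rewrite scale0r subr0; apply: submodule0.
move=> a y z [b hb] [c hc]; exists (a * b + c).
rewrite scalerDl opprD addrACA -scalerA -scalerBr.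
exact: (proj2 hU).
Qed.

(** The coefficients of x in the elements of V modulo U.  Passing from U to
    U + S x is then controlled by V :&: U and by this submodule of S, in place of
    the quotient (U + S x) / U. *)
Lemma submodule_coef M (U V : M -> Prop) (x : M) : is_submodule U -> is_submodule V ->
  is_submodule (fun a : S^o => exists y, V y /\ U (y - (a : S) *: x)).
Proof.
move=> hU hV; split.
  by exists 0; split; [apply: submodule0 | rewrite scale0r subr0; apply: submodule0].
move=> a b c [y [Vy Uy]] [z [Vz Uz]]; exists (a *: y + z); split.
  exact: (proj2 hV).
rewrite scalerDl -scalerA opprD addrACA -scalerBr.
exact: (proj2 hU).
Qed.

Lemma noetherian_add_line M (U : M -> Prop) (x : M) : is_submodule U ->
  noetherian S^o -> noetherian_sub U -> noetherian_sub (add_line U x).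
Proof.
move=> hU nS nU V hV VU.
have [s sE] : fg_sub (fun y => V y /\ U y).
  by apply: nU => [|y []//]; apply: submodule_cap.
have [t tE] := nS _ (submodule_coef x hU hV) (fun _ _ => I).
have [|r [rs rE]] := @lift_span M S^o (fun y a => V y /\ U (y - (a : S) *: x)) t.
  by move=> a /tE.
have Vr y : span r y -> V y.
  apply: span_min => // i ir.
  by have [] := rE i; rewrite -?rs.
have Ur a : span t a -> exists2 y, span r y & U (y - (a : S) *: x).
  move=> ta; have : is_submodule (fun a : S^o => exists y, span r y /\ U (y - (a : S) *: x)).
    by apply: submodule_coef => //; apply: submodule_span.
  move=> h; suff [y []] : exists y, span r y /\ U (y - (a : S) *: x) by exists y.
  apply: (span_min h) ta => i it; exists r`_i; split; last exact: (proj2 (rE i it)).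
  by apply: span_mem; rewrite rs.
exists (s ++ r) => y; rewrite span_cat; split; last first.
  by case=> u [v [/sE[Vu _] /Vr Vv ->]]; apply: submoduleD.
move=> Vy; have [a Ua] := VU y Vy.
have [|v rv Uv] := Ur a; first by apply/tE; exists y.
exists (y - v), v; split; rewrite ?subrK //; apply/sE; split.
  by apply: submoduleB => //; apply: Vr.
have -> : y - v = (y - (a : S) *: x) - (v - a *: x) by rewrite opprB addrA subrK.
exact: submoduleB.
Qed.

Definition artinian_sub M (W : M -> Prop) : Prop :=
  forall U : nat -> M -> Prop, (forall n, is_submodule (U n)) ->
    (forall n x, U n x -> W x) ->
    (forall n x, U n.+1 x -> U n x) ->
    exists n, forall m, (n <= m)%N -> forall x, U m x <-> U n x.

Lemma descend M (U : nat -> M -> Prop) : (forall n x, U n.+1 x -> U n x) ->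
  forall n m, (n <= m)%N -> forall x, U m x -> U n x.
Proof.
move=> hU n m; elim: m => [|m IH]; first by rewrite leqn0 => /eqP->.
by rewrite leq_eqVlt => /predU1P[->//|nm] x /hU; apply: IH.
Qed.

Lemma artinian_add_line M (W : M -> Prop) (x : M) : is_submodule W ->
  artinian_module S^o -> artinian_sub W -> artinian_sub (add_line W x).
Proof.
move=> hW aS aW U hU UW Ud.
have [n hn] := aW (fun n y => U n y /\ W y)
  (fun n => submodule_cap (hU n) hW) (fun n y => @proj2 _ _)
  (fun n y h => conj (Ud n y (proj1 h)) (proj2 h)).
have [|m hm] := aS (fun n a => exists y, U n y /\ W (y - (a : S) *: x))
  (fun n => submodule_coef x hW (hU n)).
  by move=> k a [y [/Ud Uy Wy]]; exists y.
exists (maxn n m) => k; rewrite geq_max => /andP[nk mk] y; split.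
  by apply: (descend Ud); rewrite geq_max nk.
move=> Uy; have [a Wy] := UW _ _ Uy.
have Umax := descend Ud (leq_maxr n m) Uy.
have /(hm _ mk a)[z [Uz Wz]] : exists y, U m y /\ W (y - (a : S) *: x) by exists y.
have Wyz : W (y - z).
  have -> : y - z = (y - (a : S) *: x) - (z - a *: x) by rewrite opprB addrA subrK.
  exact: submoduleB.
have Uyz : U n (y - z).
  exact: (submoduleB (hU n) (descend Ud (leq_maxl n m) Uy) (descend Ud nk Uz)).
have [Uk _] := proj2 (hn k nk _) (conj Uyz Wyz).
by rewrite -[y](subrK z); apply: (submoduleD (hU k)).
Qed.

Lemma span_artinian M (s : seq M) : artinian_module S^o -> artinian_sub (span s).
Proof.
move=> aS; elim: s => [|e s IH]; last first.
  by apply: artinian_add_line => //; apply: submodule_span.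
move=> U hU U0 _; exists 0%N => m _ x.
by split=> /U0 /= ->; apply: submodule0.
Qed.

Lemma span_noetherian M (s : seq M) : noetherian S^o -> noetherian_sub (span s).
Proof.
move=> nS; elim: s => [|e s IH]; last first.
  by apply: noetherian_add_line => //; apply: submodule_span.
move=> V hV V0; exists [::] => x; split=> [/V0//|/= ->]; exact: submodule0.
Qed.

Lemma fg_artinian M : artinian_module S^o -> finitely_generated M ->
  artinian_module M.
Proof.
move=> aS /fg_span[s sM] U hU Ud; apply: (@span_artinian M s) => //.
Qed.

Lemma fg_noetherian M : noetherian S^o -> finitely_generated M -> noetherian M.
Proof.
move=> nS /fg_span[s sM] V hV _; apply: (@span_noetherian M s) => //.
Qed.

Lemma noetherian_acc M (U : nat -> M -> Prop) : noetherian M ->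
  (forall n, is_submodule (U n)) -> (forall n x, U n x -> U n.+1 x) ->
  exists n, forall m x, U m x -> U n x.
Proof.
move=> nM hU Uup.
have up n m : (n <= m)%N -> forall x, U n x -> U m x.
  elim: m => [|m IH]; first by rewrite leqn0 => /eqP->.
  by rewrite leq_eqVlt => /predU1P[->//|nm] x /(IH nm); apply: Uup.
have [|//|s sE] := nM (fun x => exists n, U n x).
  split; first by exists 0%N; apply: submodule0.
  move=> a x y [n Ux] [m Uy]; exists (maxn n m).
  apply: (proj2 (hU _)); first by apply: up Ux; apply: leq_maxl.
  by apply: up Uy; apply: leq_maxr.
suff [n hn] : exists n, forall x, span s x -> U n x.
  by exists n => m x Ux; apply: hn; apply/sE; exists m.
have {sE} : forall i, (i < size s)%N -> exists n, U n s`_i.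
  by move=> i /span_mem /sE.
elim: s => [|e s IH] he.
  by exists 0%N => x /= ->; apply: submodule0.
have [n hn] := IH (fun i => he i.+1); have [m hm] := he 0%N isT.
exists (maxn n m) => x /= [a /hn Ux]; rewrite -[x](subrK (a *: e)).
apply: (submoduleD (hU _)); first by apply: up Ux; apply: leq_maxl.
by apply: submoduleZ => //; apply: up hm; apply: leq_maxr.
Qed.

End ChainConditions.

(** * Artinian commutative rings are noetherian *)

Section CommutativeHopkins.
Variable R : comNzRingType.
Local Notation RR := (R^o : lmodType R).
Hypothesis artR : artinian_module RR.

Lemma mul_map (r : R) : exists f : {linear RR -> RR}, forall x : R, f x = r * x.
Proof.
have [|f fE] := @linear_map R RR RR (fun x : R => r * x); last by exists f.
by move=> a x y /=; rewrite mulrDr; congr (_ + _); apply: mulrCA.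
Qed.

Lemma fg_add_line (U V : RR -> Prop) (y : R) : is_submodule V ->
  V y -> fg_sub (fun x => V x /\ U x) ->
  (forall x : RR, V x -> exists a : R, U (x - a *: (y : RR))) ->
  fg_sub V.
Proof.
move=> hV Vy [s sE] VU; exists ((y : RR) :: s) => x /=; split.
  move=> Vx; have [a Ua] := VU x Vx; exists a; apply/sE; split=> //.
  by apply: submoduleB => //; apply: submoduleZ.
case=> a /sE [Vxy _]; rewrite -[x](subrK (a *: (y : RR))).
by apply: submoduleD => //; apply: submoduleZ.
Qed.

(** If the ring were not noetherian, some ideal I would be minimal among the
    non-noetherian ones.  Multiplication by r on I has kernel and image in I, and I
    is an extension of one by the other, so r I = 0 or r I = I; in the second case
    the descending chain condition on the ideals (r ^ n) makes r invertible on I.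
    Thus I is a vector space over a field.  Zorn's lemma gives a subspace H maximal
    among those missing a fixed nonzero x.  It has codimension 1, and being smaller
    than I it is noetherian, hence so is I: a contradiction. *)
Theorem commutative_hopkins : noetherian RR.
Proof.
apply/not_notP => nnoeth.
have [I [hI nI Imin]] := artinian_min (B := fun U => ~ noetherian_sub U) artR
  (submodule_all RR) nnoeth.
have {}Imin J : strict_sub J I -> noetherian_sub J.
  by move=> JI; apply/not_notP => nJ; apply: Imin JI nJ.
have IR (r x : R) : I x -> I (r * x) by move=> Ix; apply: (submoduleZ hI r Ix).
(* Ideals strictly inside I are noetherian, so the kernel and the image of r on I
   cannot both be proper. *)
have dich (r : R) : (forall x : R, I x -> r * x = 0) \/
    (forall x : R, I x -> exists2 y : R, I y & r * y = x).
  apply/not_notP => /not_orP[n0 n1]; apply: nI.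
  have [f fE] := mul_map r; apply: (noetherian_extension (f := f) hI).
    apply: Imin; split=> [|x []//|].
      exact: (submodule_cap hI (submodule_preim f (submodule_zero RR))).
    apply/not_notP => h; apply: n0 => x Ix; apply/not_notP => rx.
    by apply: h; exists x => // -[_]; rewrite fE.
  apply: Imin; split.
  - exact: submodule_im.
  - by move=> _ [x Ix <-]; rewrite fE; apply: IR.
  apply/not_notP => h; apply: n1 => x Ix; apply/not_notP => rx.
  apply: h; exists x => // -[y Iy fy]; apply: rx; exists y => //.
  by rewrite -fy fE.
have [x Ix nx0] : exists2 x : R, I x & x <> 0.
  apply/not_notP => h; apply: nI => V hV VI; exists [::] => x /=; split.
    by move=> /VI Ix; apply/not_notP => nx; apply: h; exists x.
  by move=> ->; apply: submodule0.
have [H [hH _ HQ Hmax]] := zorn_submodule (Q := fun y : RR => I y /\ y <> x)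
  (submodule_zero RR) (fun y y0 => conj (eq_ind_r I (submodule0 hI) y0)
     (fun yx => nx0 (etrans (esym yx) y0))).
(* By maximality of H, adding y to H makes x appear. *)
have xin y : I y -> ~ H y -> exists a : R, H (x - a * y).
  move=> Iy nHy; apply/not_notP => nxy; apply: nHy.
  apply: (Hmax (add_line H y)); first exact: submodule_add_line.
  - by move=> z Hz; exists 0; rewrite scale0r subr0.
  - move=> z [a Ha]; split; last by move=> zx; apply: nxy; exists a; rewrite -zx.
    by rewrite -[z](subrK (a *: y)); apply: (submoduleD hI); [case: (HQ _ Ha) | apply: IR].
  by exists 1; rewrite scale1r subrr; apply: submodule0.
have Hx z : I z -> exists a : R, H (z - a * x).
  move=> Iz; have [Hz|nHz] := pselect (H z); first by exists 0; rewrite mul0r subr0.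
  have [r Hr] := xin z Iz nHz.
  have [r0|ronto] := dich r.
    by have [_ []] := HQ _ Hr; rewrite r0 // subr0.
  (* Since r I = I, an identity r ^ n = s r ^ (n + 1) says that s inverts r on I. *)
  have Ipow n w : I w -> exists2 v : R, I v & r ^+ n * v = w.
    elim: n w => [|n IH] w Iw; first by exists w; rewrite // expr0 mul1r.
    by have [v /IH[u Iu <-] <-] := ronto w Iw; exists u; rewrite // exprS mulrA.
  have [n hn] := artR (U := fun n y => exists a, y = a *: (r ^+ n : RR))
    (fun n => submodule_line _) (fun n y => fun '(ex_intro a h) =>
      ex_intro _ (a * r) (etrans h (etrans (congr1 ( *%R a) (exprS r n)) (mulrA _ _ _)))).
  have [s rs] : exists s : R, r ^+ n = s * r ^+ n.+1.
    apply: (proj2 (hn n.+1 (leqnSn n) (r ^+ n))); exists 1; exact: (esym (mul1r _)).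
  exists s; have [v Iv vz] := Ipow n z Iz.
  have -> : z - s * x = - (s * (x - r * z)).
    suff zE : s * (r * z) = z by rewrite mulrBr zE opprB.
    by rewrite -vz [in RHS]rs exprS !mulrA.
  exact: (submoduleN hH (submoduleZ hH s Hr)).
have Hnoeth : noetherian_sub H.
  apply: Imin; split=> // [y /HQ[]//|]; exists x => // /HQ[_]; exact.
apply: nI => V hV VI.
(* Any y of V outside H spans I together with H, so V = (V :&: H) + R y. *)
have [VH|] := pselect (forall y, V y -> H y); first exact: Hnoeth.
move=> /existsNP[y /not_implyP[Vy nHy]].
apply: (@fg_add_line H V y) => //.
  by apply: Hnoeth => [|z []//]; apply: submodule_cap.
move=> z Vz; have [a Ha] := Hx z (VI _ Vz).
have [b Hb] := xin y (VI _ Vy) nHy.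
exists (a * b); have -> : z - (a * b) *: (y : RR) = (z - a * x) + a *: (x - b * y : RR).
  by rewrite scalerBr addrA subrK /GRing.scale /= mulrA.
by apply: submoduleD => //; apply: submoduleZ.
Qed.

End CommutativeHopkins.

Section ArtinAlgebra.
Variables (R : comNzRingType) (A : algType R).
Hypothesis artinA : artin_algebra A.

(** The action of R on A is central, so right ideals of A are R-submodules and
    inherit both chain conditions from the finitely generated R-module A. *)
Lemma right_submodule (U : (A^c)^o -> Prop) : is_submodule U ->
  is_submodule (fun x : (A : lmodType R) => U x).
Proof.
move=> hU; split; first exact: submodule0 hU.
move=> a x y Ux Uy; have := proj2 hU (a%:A : A) x y Ux Uy.
by congr U; congr (_ + _); rewrite -[RHS]mulr1 -scalerAl scalerAr.
Qed.

Lemma artin_algebra_artinian : artinian_module ((A^c)^o : rmodType A).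
Proof.
have [artR fgA] := artinA; move=> U hU Ud.
exact: (fg_artinian artR fgA (fun n => right_submodule (hU n)) Ud).
Qed.

Lemma artin_algebra_noetherian : noetherian ((A^c)^o : rmodType A).
Proof.
have [artR fgA] := artinA; move=> V hV _.
have [|//|s sE] := fg_noetherian (commutative_hopkins artR) fgA (V := fun x => V x).
  exact: right_submodule.
exists (s : seq (A^c)^o) => x; split; last first.
  apply: span_min => // i it; apply/sE; exact: span_mem.
move/sE; have h : is_submodule (fun x : (A : lmodType R) => span (s : seq ((A^c)^o)) x).
  exact/right_submodule/submodule_span.
apply: (span_min h) => i it; exact: (@span_mem _ ((A^c)^o : rmodType A) s i it).
Qed.

End ArtinAlgebra.

(** * Direct sums and projective modules *)

Section ProductsProjectives.
Variable S : pzRingType.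
Implicit Types K M N P Q X Y C I : lmodType S.

Lemma iso_refl M : isomorphic M M.
Proof. by exists (idfun : {linear M -> M}); exists idfun. Qed.

Lemma iso_sym M N : isomorphic M N -> isomorphic N M.
Proof. by case/iso_linear=> f [g [fg gf]]; exists g; exists f. Qed.

Lemma iso_trans M N P : isomorphic M N -> isomorphic N P -> isomorphic M P.
Proof. by case=> f bf [g bg]; exists (g \o f : {linear M -> P}); apply: bij_comp. Qed.

Lemma pair_map M N P (f : {linear M -> N}) (g : {linear M -> P}) :
  exists h : {linear M -> (N * P)%type}, forall x, h x = (f x, g x).
Proof. by apply: linear_map => a x y; rewrite !linearP. Qed.

Lemma copair_map M N P (f : {linear M -> P}) (g : {linear N -> P}) :
  exists h : {linear (M * N)%type -> P}, forall x, h x = f x.1 + g x.2.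
Proof.
by apply: linear_map => a x y /=; rewrite !linearP scalerDr addrACA.
Qed.

Lemma inl_map M N : exists h : {linear M -> (M * N)%type}, forall x, h x = (x, 0).
Proof. exact: (pair_map (idfun : {linear M -> M}) (\0 : {linear M -> N})). Qed.

Lemma inr_map M N : exists h : {linear N -> (M * N)%type}, forall x, h x = (0, x).
Proof. exact: (pair_map (\0 : {linear N -> M}) (idfun : {linear N -> N})). Qed.

Lemma iso_prod M M' N N' : isomorphic M M' -> isomorphic N N' ->
  isomorphic (M * N)%type (M' * N')%type.
Proof.
case/iso_linear=> f [f' [ff' f'f]] /iso_linear[g [g' [gg' g'g]]].
have [h hE] := pair_map (f \o fst : {linear (M * N)%type -> M'})
  (g \o snd : {linear (M * N)%type -> N'}).
exists h; exists (fun w => (f' w.1, g' w.2)) => [] [x y]; rewrite hE /=.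
  by rewrite ff' gg'.
by rewrite f'f g'g.
Qed.

Lemma iso_prodC M N : isomorphic (M * N)%type (N * M)%type.
Proof.
have [h hE] := pair_map (snd : {linear (M * N)%type -> N})
  (fst : {linear (M * N)%type -> M}).
by exists h; exists (fun w => (w.2, w.1)) => [] [x y]; rewrite hE.
Qed.

Lemma iso_prodA M N P : isomorphic (M * (N * P))%type (M * N * P)%type.
Proof.
have [|h hE] := @linear_map S (M * (N * P))%type (M * N * P)%type
  (fun w => (w.1, w.2.1, w.2.2)); first by move=> a [x [y z]] [x' [y' z']].
by exists h; exists (fun w => (w.1.1, (w.1.2, w.2))) => [[x [y z]]|[[x y] z]];
  rewrite hE.
Qed.

Lemma iso_prod0 M N : is_zero M -> isomorphic (M * N)%type N.
Proof.
move=> M0; exists (snd : {linear (M * N)%type -> N}).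
by exists (fun y => (0, y)) => // [] [x y]; rewrite (M0 x).
Qed.

Lemma fg_surj M N (f : {linear M -> N}) : surjective f ->
  finitely_generated M -> finitely_generated N.
Proof.
move=> fs /fg_span[s sM]; apply/fg_span; exists (map f s) => y.
by have [x <-] := fs y; apply/span_im; exists x.
Qed.

Lemma fg_prod M N : finitely_generated M -> finitely_generated N ->
  finitely_generated (M * N)%type.
Proof.
move=> /fg_span[s sM] /fg_span[t tN]; apply/fg_span.
have [i iE] := inl_map M N; have [j jE] := inr_map M N.
exists (map i s ++ map j t) => w; apply/span_cat.
exists (i w.1), (j w.2); split.
- by apply/span_im; exists w.1.
- by apply/span_im; exists w.2.
by rewrite iE jE; case: w => x y; congr (_, _); rewrite ?addr0 ?add0r.
Qed.

Lemma fg_submod M (U : M -> Prop) (hU : is_submodule U) : noetherian M ->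
  finitely_generated (submod hU).
Proof.
move=> nM; have [//|s sE] := nM U hU.
have [t tE] : exists t : seq (submod hU), map (sub_incl hU) t = s.
  have : forall i, (i < size s)%N -> U s`_i by move=> i /span_mem /sE.
  elim: s {sE} => [|e s IH] h; first by exists [::].
  have [t tE] := IH (fun i => h i.+1).
  have [y yE] := sub_incl_onto hU (h 0%N isT).
  by exists (y :: t); rewrite /= tE; congr (_ :: _).
apply/fg_span; exists t => x.
have /sE := sub_inclP x.
by rewrite -tE => /span_im[y ty /sub_incl_inj <-].
Qed.

Lemma zero_fg M : is_zero M -> finitely_generated M.
Proof. by move=> M0; apply/fg_span; exists [::] => x; apply: M0. Qed.

Lemma projective_retract P Q (r : {linear Q -> P}) (s : {linear P -> Q}) :
  cancel s r -> projective Q -> projective P.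
Proof.
move=> sr pQ M N g f gs; have [h hE] := pQ M N g (f \o r : {linear Q -> N}) gs.
by exists (h \o s : {linear P -> M}) => x /=; rewrite hE /= sr.
Qed.

Lemma projective_iso P Q : isomorphic P Q -> projective P -> projective Q.
Proof. by case/iso_linear=> f [g [fg gf]]; apply: projective_retract gf. Qed.

Lemma projective_zero P : is_zero P -> projective P.
Proof.
move=> P0 M N g f gs; exists (\0 : {linear P -> M}) => x.
by rewrite (P0 x) !linear0.
Qed.

Lemma projective_prod P Q : projective P -> projective Q ->
  projective (P * Q)%type.
Proof.
move=> pP pQ M N g f gs.
have [i iE] := inl_map P Q; have [j jE] := inr_map P Q.
have [h hE] := pP M N g (f \o i : {linear P -> N}) gs.
have [k kE] := pQ M N g (f \o j : {linear Q -> N}) gs.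
have [l lE] := copair_map h k; exists l => -[x y].
rewrite lE linearD hE kE /= iE jE -linearD; congr (f (_, _)).
  exact: addr0.
exact: add0r.
Qed.

Lemma projective_fst P Q : projective (P * Q)%type -> projective P.
Proof.
have [i iE] := inl_map P Q.
apply: (projective_retract (r := (fst : {linear (P * Q)%type -> P})) (s := i)).
by move=> x; rewrite iE.
Qed.

Lemma projective_row n : projective ('rV[S]_n : lmodType S).
Proof.
move=> M N g f gs.
have [m mE] : exists m : 'I_n -> M, forall i, g (m i) = f (delta_mx 0 i).
  have ex i : exists x, g x = f (delta_mx 0 i) by apply: gs.
  by exists (fun i => sval (cid (ex i))) => i; case: cid.
have [|h hE] := @linear_map S 'rV[S]_n M (fun v => \sum_i v 0 i *: m i).
  move=> a u v; rewrite scaler_sumr -big_split; apply: eq_bigr => i _ /=.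
  by rewrite !mxE scalerDl scalerA.
exists h => v; rewrite hE linear_sum /= [in RHS](row_sum_delta v) linear_sum.
by apply: eq_bigr => i _; rewrite !linearZ /= mE.
Qed.

Lemma row_fg n : finitely_generated ('rV[S]_n : lmodType S).
Proof.
exists n, (fun i => delta_mx 0 i) => v; exists (fun i => v 0 i).
exact: row_sum_delta.
Qed.

Lemma fg_free_cover M : finitely_generated M ->
  exists n (f : {linear 'rV[S]_n -> M}), surjective f.
Proof.
case=> n [e eP].
have [|f fE] := @linear_map S 'rV[S]_n M (fun v => \sum_i v 0 i *: e i).
  move=> a u v; rewrite scaler_sumr -big_split; apply: eq_bigr => i _ /=.
  by rewrite !mxE scalerDl scalerA.
exists n, f => x; have [a ->] := eP x; exists (\row_i a i).
by rewrite fE; apply: eq_bigr => i _; rewrite mxE.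
Qed.

Lemma iter_linear M (f : {linear M -> M}) n :
  exists g : {linear M -> M}, forall x, g x = iter n f x.
Proof.
elim: n => [|n [g gE]]; first by exists (idfun : {linear M -> M}).
by exists (f \o g : {linear M -> M}) => x /=; rewrite gE.
Qed.

Lemma submodule_ker_iter M (f : {linear M -> M}) n :
  is_submodule (fun x => iter n f x = 0).
Proof.
have [g gE] := iter_linear f n.
have := submodule_preim g (submodule_zero M).
by congr is_submodule; apply: funext => x; rewrite gE.
Qed.

(** The kernels of the iterates of f form an ascending chain; an element x of the
    kernel of f is f ^ n (y) with y in the kernel of f ^ (n + 1), so x = 0 once the
    chain is stationary from n on. *)
Lemma noetherian_surj_inj M (f : {linear M -> M}) : noetherian M ->
  surjective f -> injective f.
Proof.
move=> nM fs; apply: linear_inj => x fx0.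
have [||n hn] := @noetherian_acc S M (fun n x => iter n f x = 0) nM.
- exact: submodule_ker_iter.
- by move=> n y /= ->; rewrite linear0.
have [y yx] : exists y, iter n f y = x.
  elim: n {hn} => [|n [z zx]]; first by exists x.
  by have [y yz] := fs z; exists y; rewrite iterSr yz.
by rewrite -yx; apply: (hn n.+1); rewrite /= yx.
Qed.

End ProductsProjectives.

(** * Syzygies, stable retracts and the vanishing of Ext *)

Section Presentations.
Variable S : pzRingType.
Implicit Types K M N P Q X Y C D I U V G : lmodType S.

(** An exact sequence 0 -> K -> P -> X -> 0 with P projective, so that K is a
    syzygy of X that need not be minimal. *)
Definition presentation K P X (i : {linear K -> P}) (p : {linear P -> X}) : Prop :=
  [/\ projective P, injective i, surjective p & exact_at i p].

Definition syzygy_of K X : Prop :=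
  exists P (i : {linear K -> P}) (p : {linear P -> X}), presentation i p.

Lemma syzygy_syzygy_of K X : is_syzygy K X -> syzygy_of K X.
Proof. by case=> P [i [f [[pP fs _] ii ex]]]; exists P, i, f. Qed.

(** X is a direct summand of Y in the stable category: the identity of X is a
    composite through Y up to a map that factors through a projective. *)
Definition stable_retract X Y : Prop :=
  exists Q (f : {linear X -> Y}) (g : {linear Y -> X})
         (a : {linear X -> Q}) (b : {linear Q -> X}),
    projective Q /\ forall x, x = g (f x) + b (a x).

Lemma retract_stable X Y (f : {linear X -> Y}) (g : {linear Y -> X}) :
  cancel f g -> stable_retract X Y.
Proof.
move=> fg; exists ('rV[S]_0), f, g, (\0 : {linear _ -> _}), (\0 : {linear _ -> _}).
by split; [apply: projective_row | move=> x; rewrite fg addr0].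
Qed.

Lemma stable_retract_refl X : stable_retract X X.
Proof. exact: (@retract_stable _ _ (idfun : {linear X -> X}) (idfun : {linear X -> X})). Qed.

Lemma exact_comp0 K P X (i : {linear K -> P}) (p : {linear P -> X}) k :
  exact_at i p -> p (i k) = 0.
Proof. by move=> ex; apply/ex; exists k. Qed.

(** The maps between X and Y lift to the projectives and restrict to the kernels.
    The identity of P differs from the lifted composite by a lift of the map through
    Q and by a map t with values in K; on K only t survives. *)
Lemma stable_retract_lift K P X K' P' Y (i : {linear K -> P}) (p : {linear P -> X})
    (i' : {linear K' -> P'}) (p' : {linear P' -> Y}) :
  presentation i p -> presentation i' p' -> stable_retract X Y ->
  exists (F : {linear P -> P'}) (G : {linear K -> K'}) (H : {linear K' -> K})
         (t : {linear P -> K}),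
    (forall k, i' (G k) = F (i k)) /\ forall k, k = H (G k) + t (i k).
Proof.
move=> [pP ii ps ex] [pP' ii' ps' ex'] [Q [f [g [a [b [pQ fgab]]]]]].
have [F FE] := pP P' Y p' (f \o p : {linear P -> Y}) ps'.
have [gh ghE] := pP' P X p (g \o p' : {linear P' -> X}) ps.
have [bh bhE] := pQ P X p b ps.
have [G GE] : exists G : {linear K -> K'}, forall k, i' (G k) = (F \o i) k.
  by apply: factor_inj => // k; apply/ex'; rewrite FE /= (exact_comp0 _ ex) linear0.
have [H HE] : exists H : {linear K' -> K}, forall k, i (H k) = (gh \o i') k.
  by apply: factor_inj => // k; apply/ex; rewrite ghE /= (exact_comp0 _ ex') linear0.
pose m := (idfun \- ((gh \o F) \+ (bh \o (a \o p)))) : {linear P -> P}.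
have mE x : m x = x - (gh (F x) + bh (a (p x))) by [].
have [t tE] : exists t : {linear P -> K}, forall x, i (t x) = m x.
  apply: factor_inj => // x; apply/ex; rewrite mE linearB linearD ghE bhE /= FE /=.
  by rewrite -fgab subrr.
exists F, G, H, t; split=> [//|k]; apply: ii.
rewrite linearD HE tE mE (exact_comp0 _ ex) !linear0 addr0 /= -[i' _]/(i' (G k)) GE /=.
by rewrite addrC subrK.
Qed.

(** On K, the correction t is defined on all of P, hence factors through a
    projective: taking syzygies preserves stable retracts. *)
Lemma stable_retract_syzygy K K' X Y : syzygy_of K X -> syzygy_of K' Y ->
  stable_retract X Y -> stable_retract K K'.
Proof.
move=> [P [i [p pip]]] [P' [i' [p' pip']]] /(stable_retract_lift pip pip').
by case=> F [G [H [t [_ tE]]]]; exists P, G, H, i, t; split=> //; case: pip.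
Qed.

Lemma stable_retract_projective X Y : stable_retract X Y -> projective Y ->
  projective X.
Proof.
move=> [Q [f [g [a [b [pQ fgab]]]]]] pY.
have [s sE] := pair_map f a; have [r rE] := copair_map g b.
apply: (projective_retract (r := r) (s := s)) (projective_prod pY pQ).
by move=> x; rewrite rE sE -fgab.
Qed.

(** Vanishing of Ext^1(X, C), read off the long exact sequence of a presentation
    of X; quantifying over all presentations makes the notion independent of a
    choice, and ext1_stable_retract shows that one presentation suffices. *)
Definition ext1_zero X C : Prop :=
  forall K P (i : {linear K -> P}) (p : {linear P -> X}), presentation i p ->
  forall f : {linear K -> C}, exists h : {linear P -> C}, forall k, h (i k) = f k.

Lemma ext1_stable_retract X Y K P C (i : {linear K -> P}) (p : {linear P -> Y}) :
  stable_retract X Y -> presentation i p ->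
  (forall f : {linear K -> C}, exists h : {linear P -> C}, forall k, h (i k) = f k) ->
  ext1_zero X C.
Proof.
move=> XY pip hip K0 P0 i0 p0 pip0 f.
have [F [G [H [t [GE HE]]]]] := stable_retract_lift pip0 pip XY.
have [h hE] := hip (f \o H : {linear K -> C}).
exists ((h \o F) \+ (f \o t) : {linear P0 -> C}) => k /=.
by rewrite -GE hE /= -linearD -HE.
Qed.

Lemma ext1_retract X Y C : stable_retract X Y -> (exists K, syzygy_of K Y) ->
  ext1_zero Y C -> ext1_zero X C.
Proof.
move=> XY [K [P [i [p pip]]]] YC.
exact: (ext1_stable_retract XY pip (YC K P i p pip)).
Qed.

Lemma ext1_injective X C : injective_module C -> ext1_zero X C.
Proof. by move=> iC K P i p [_ ii _ _] f; apply: iC. Qed.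

(** Dimension shifting, Ext^1(K, C) = Ext^2(X, C) = Ext^1(X, C').  A map from K1
    to C extends to I by injectivity, the extension induces a map from K to C',
    which extends to P and lifts to I; subtracting this lift brings the extension
    back into C. *)
Lemma ext1_shift_down C I C' K P X (j : {linear C -> I}) (q : {linear I -> C'})
    (i : {linear K -> P}) (p : {linear P -> X}) :
  injective_module I -> injective j -> surjective q -> exact_at j q ->
  presentation i p -> ext1_zero X C' -> ext1_zero K C.
Proof.
move=> iI ij qs ex pip XC K1 P1 i1 p1 [pP1 ii1 ps1 ex1] f.
have [h hE] := iI K1 P1 i1 (j \o f : {linear K1 -> I}) ii1.
have [m mE] : exists m : {linear K -> C'}, forall x, m (p1 x) = (q \o h) x.
  apply: factor_surj => // x /ex1[k <-] /=.
  by rewrite hE /= (exact_comp0 _ ex).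
have [n nE] := XC K P i p pip m; have [pP _ _ _] := pip.
have [n' n'E] := pP I C' q n qs.
have [g gE] : exists g : {linear P1 -> C},
    forall x, j (g x) = (h \- (n' \o (i \o p1)) : {linear P1 -> I}) x.
  apply: factor_inj => // x; apply/ex => /=.
  by rewrite linearB n'E nE mE /= subrr.
exists g => k; apply: ij; rewrite gE /= (exact_comp0 _ ex1) !linear0 addr0.
exact: hE.
Qed.

(** The converse shift: since Ext^1(K, C) = 0, a map from K to C' lifts to I, and
    from there it extends to P. *)
Lemma ext1_shift_up C I C' K X (j : {linear C -> I}) (q : {linear I -> C'}) :
  injective_module I -> injective j -> surjective q -> exact_at j q ->
  syzygy_of K X -> (exists K2, syzygy_of K2 K) -> ext1_zero K C ->
  ext1_zero X C'.
Proof.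
move=> iI ij qs ex [P [i [p pip]]] [K2 [P1 [i1 [p1 pip1]]]] KC.
apply: (ext1_stable_retract (stable_retract_refl X) pip) => f.
have [pP ii ps exip] := pip; have [pP1 ii1 ps1 ex1] := pip1.
have [h hE] := pP1 I C' q (f \o p1 : {linear P1 -> C'}) qs.
have [m mE] : exists m : {linear K2 -> C}, forall x, j (m x) = (h \o i1) x.
  apply: factor_inj => // x; apply/ex => /=.
  by rewrite hE /= (exact_comp0 _ ex1) linear0.
have [n nE] := KC _ _ _ _ pip1 m.
have [l lE] : exists l : {linear K -> I},
    forall x, l (p1 x) = (h \- (j \o n) : {linear P1 -> I}) x.
  by apply: factor_surj => // x /ex1[k <-] /=; rewrite nE mE subrr.
have [g gE] := iI _ _ i l ii.
exists (q \o g : {linear P -> C'}) => k /=; rewrite gE.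
have [x <-] := ps1 k.
by rewrite lE /= linearB hE (exact_comp0 _ ex) subr0.
Qed.

(** V is the pushout of U and P over K, so extensions along K -> P give extensions
    along U -> V. *)
Lemma ext1_extend X C U V (u : {linear U -> V}) (v : {linear V -> X})
    (f : {linear U -> C}) :
  (exists K, syzygy_of K X) -> ext1_zero X C ->
  injective u -> surjective v -> exact_at u v ->
  exists g : {linear V -> C}, forall x, g (u x) = f x.
Proof.
move=> [K [P [i [p pip]]]] XC ui vs ex.
have [pP ii ps exip] := pip.
have [l lE] := pP V X v p vs.
have [G GE] : exists G : {linear K -> U}, forall x, u (G x) = (l \o i) x.
  by apply: factor_inj => // x; apply/ex; rewrite /= lE (exact_comp0 _ exip).
have [h hE] := XC _ _ _ _ pip (f \o G : {linear K -> C}).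
have [m mE] := copair_map u l; have [n nE] := copair_map f h.
have [|w|g gE] := factor_surj (p := m) (h := n).
- move=> y; have [z zE] := ps (v y).
  have [x xE] : exists x, u x = y - l z by apply/ex; rewrite linearB lE zE subrr.
  by exists (x, z); rewrite mE /= xE subrK.
- case: w => x z; rewrite mE nE /= => e0.
  have [k kz] : exists k, i k = z.
    by apply/exip; rewrite -lE -[l z](addKr (u x)) e0 addr0 linearN (exact_comp0 _ ex) oppr0.
  rewrite -kz hE /= -linearD; suff -> : x + G k = 0 by rewrite linear0.
  by apply: ui; rewrite linearD GE /= kz e0 linear0.
exists g => x; have := gE (x, 0).
by rewrite mE nE /= !linear0 !addr0.
Qed.

Lemma ext1_retract_right X C D (r : {linear D -> C}) (s : {linear C -> D}) :
  cancel s r -> ext1_zero X D -> ext1_zero X C.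
Proof.
move=> sr XD K P i p pip f.
have [h hE] := XD _ _ _ _ pip (s \o f : {linear K -> D}).
by exists (r \o h : {linear P -> C}) => k /=; rewrite hE /= sr.
Qed.

Lemma ext1_row X n : ext1_zero X S^o -> ext1_zero X ('rV[S]_n : lmodType S).
Proof.
move=> XS K P i p pip f.
have comp (j : 'I_n) : exists h : {linear P -> S^o}, forall k, h (i k) = f k 0 j.
  have [|c cE] := @linear_map S K S^o (fun k => f k 0 j).
    by move=> a x y; rewrite linearP !mxE.
  by have [h hE] := XS _ _ _ _ pip c; exists h => k; rewrite hE cE.
pose h j := sval (cid (comp j)).
have hE j k : h j (i k) = f k 0 j by rewrite /h; case: cid.
have [|g gE] := @linear_map S P 'rV[S]_n (fun x => \row_j (h j x : S)).
  by move=> a x y; apply/rowP => j; rewrite !mxE linearP.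
by exists g => k; apply/rowP => j; rewrite gE !mxE hE.
Qed.

Lemma ext1_fg_projective X Q : finitely_generated Q -> projective Q ->
  ext1_zero X S^o -> ext1_zero X Q.
Proof.
move=> /fg_free_cover[n [f fs]] pQ XS.
have [s sE] := pQ _ _ f (idfun : {linear Q -> Q}) fs.
by apply: (ext1_retract_right (r := f) (s := s)); [move=> x; rewrite sE | apply: ext1_row].
Qed.

(** Extending the identity of K splits the presentation. *)
Lemma ext1_split X K P (i : {linear K -> P}) (p : {linear P -> X}) :
  presentation i p -> ext1_zero X K -> projective X.
Proof.
move=> pip XK; have [pP ii ps ex] := pip.
have [r rE] := XK _ _ _ _ pip (idfun : {linear K -> K}).
have [s sE] : exists s : {linear X -> P},
    forall x, s (p x) = ((idfun : {linear P -> P}) \- (i \o r) : {linear P -> P}) x.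
  by apply: factor_surj => // x /ex[k <-] /=; rewrite rE subrr.
apply: (projective_retract (r := p) (s := s)) pP => x.
have [y <-] := ps x; rewrite sE /= linearB (exact_comp0 _ ex); exact: subr0.
Qed.

(** Schanuel's lemma read backwards: extend i and j along each other, to v and u.
    The maps (a, b) |-> (p a, b - u a) and (a, b) |-> (q b, a - v b) on P0 * P1 are
    onto and both have kernel {(i g, j g)}. *)
Lemma dual_schanuel G P0 P1 X Y (i : {linear G -> P0}) (p : {linear P0 -> X})
    (j : {linear G -> P1}) (q : {linear P1 -> Y}) :
  presentation i p -> presentation j q -> ext1_zero X P1 -> ext1_zero Y P0 ->
  isomorphic (X * P1)%type (Y * P0)%type.
Proof.
move=> pip pjq XP YP; have [_ ii ps exi] := pip; have [_ ij qs exj] := pjq.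
have [u uE] := XP _ _ _ _ pip j; have [v vE] := YP _ _ _ _ pjq i.
have [|a aE] := @linear_map S (P0 * P1)%type (X * P1)%type
    (fun w => (p w.1, w.2 - u w.1)).
  move=> c [x y] [x' y'] /=; congr (_, _); first by rewrite linearP.
  by rewrite linearP opprD addrACA -scalerBr.
have [|b bE] := @linear_map S (P0 * P1)%type (Y * P0)%type
    (fun w => (q w.2, w.1 - v w.2)).
  move=> c [x y] [x' y'] /=; congr (_, _); first by rewrite linearP.
  by rewrite linearP opprD addrACA -scalerBr.
apply: (same_kernel_iso (p := a) (q := b)).
- move=> [x y]; have [z zx] := ps x; exists (z, y + u z).
  by rewrite aE /= zx addrK.
- move=> [x y]; have [z zx] := qs x; exists (y + v z, z).
  by rewrite bE /= zx addrK.
move=> [x y]; rewrite aE bE /=; split=> -[].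
  move=> /exi[g <-] /eqP; rewrite uE subr_eq0 => /eqP ->.
  by rewrite vE subrr (exact_comp0 _ exj).
move=> /exj[g <-] /eqP; rewrite vE subr_eq0 => /eqP ->.
by rewrite uE subrr (exact_comp0 _ exi).
Qed.

End Presentations.

(** * Projective and injective dimension *)

Section Dimensions.
Variable S : pzRingType.
Implicit Types K M N P Q X Y C D I U V G : lmodType S.

Lemma row0_zero : is_zero ('rV[S]_0 : lmodType S).
Proof. by move=> x; apply: thinmx0. Qed.

Definition cons_seq M (P : nat -> lmodType S) (i : nat) : lmodType S :=
  if i is j.+1 then P j else M.

(** The bounds on dimensions are unfolded one syzygy (or cosyzygy) at a time, which
    is the form that dimension shifting uses. *)
Fixpoint pd_le (n : nat) M : Prop :=
  if n is n'.+1 then exists K, syzygy_of K M /\ pd_le n' K else projective M.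

Lemma pd_leP M n : has_projective_resolution M n <-> pd_le n M.
Proof.
split.
  elim: n M => [|n IH] M [P [d [e [pP es ex0 ex P0]]]] /=.
    have [r [_ re]] : exists g : {linear M -> P 0%N}, cancel e g /\ cancel g e.
      apply: linear_inv; split=> //; apply: linear_inj => x /ex0[y <-].
      by rewrite (P0 1%N isT y) linear0.
    exact: (projective_retract (r := e) (s := r)).
  have hK := submodule_preim e (submodule_zero M).
  exists (submod hK); split.
    exists (P 0%N), (sub_incl hK), e; split=> //; first exact: sub_incl_inj.
    move=> y; split; first exact: sub_incl_onto.
    by case=> x <-; apply: (sub_inclP (hU := hK)).
  have [d0 d0E] := sub_corestr hK (f := d 0%N) (fun x => exact_comp0 x ex0).
  apply: IH; exists (fun i => P i.+1), (fun i => d i.+1), d0; split=> //.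
  - move=> y; have /ex0[x xE] := sub_inclP (hU := hK) y; exists x.
    by apply: (@sub_incl_inj _ _ _ hK); rewrite d0E.
  - move=> y; rewrite -(ex 0%N) -d0E; split=> [->|e0]; first exact: linear0.
    by apply: (@sub_incl_inj _ _ _ hK); rewrite e0 linear0.
  by move=> i ni; apply: P0.
elim: n M => [|n IH] M /=.
  move=> pM; pose Z := 'rV[S]_0 : lmodType S.
  have Z0 := row0_zero.
  exists (cons_seq M (fun=> Z)), (fun i => \0 : {linear Z -> cons_seq M (fun=> Z) i}),
    (idfun : {linear M -> M}); split.
  - by case=> // i; apply: projective_row.
  - by move=> y; exists y.
  - by move=> y; split=> [/= ->|[_ <-] //]; exists 0.
  - by move=> i y; split=> // _; exists 0; rewrite [RHS]Z0.
  - by case.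
case=> K [[P [i [p [pP ii ps ex]]]] /IH[P' [d' [e' [pP' es' ex0' ex' P0']]]]].
exists (cons_seq P P'),
  (fun j => match j return {linear P' j -> cons_seq P P' j} with
   | 0%N => i \o e' : {linear P' 0%N -> P} | j'.+1 => d' j' end), p; split.
- by case.
- by [].
- move=> y; rewrite ex; split=> [[k <-]|[x <-]]; last by exists (e' x).
  by have [x <-] := es' k; exists x.
- case=> [|j] /=; last exact: ex'.
  move=> y /=; rewrite -ex0'; split=> [iy|->]; last exact: linear0.
  by apply: ii; rewrite linear0.
- by case=> // j nj; apply: P0'.
Qed.

Fixpoint injdim_le (n : nat) C : Prop :=
  if n is n'.+1 then exists I C' (j : {linear C -> I}) (q : {linear I -> C'}),
    [/\ injective_module I, injective j, surjective q & exact_at j q] /\ injdim_le n' C'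
  else injective_module C.

Lemma injective_retract I (J : lmodType S) (r : {linear J -> I}) (s : {linear I -> J}) :
  cancel s r -> injective_module J -> injective_module I.
Proof.
move=> sr iJ M N g f gi; have [h hE] := iJ M N g (s \o f : {linear M -> J}) gi.
by exists (r \o h : {linear N -> I}) => x /=; rewrite hE /= sr.
Qed.

Lemma injdim_leP C n : has_injective_resolution C n <-> injdim_le n C.
Proof.
split.
  elim: n C => [|n IH] C [I [d [e [iI ei ex0 ex I0]]]] /=.
    have [r [er _]] : exists g : {linear I 0%N -> C}, cancel e g /\ cancel g e.
      apply: linear_inv; split=> // y; apply/ex0; exact: (I0 1%N isT).
    exact: (injective_retract (r := r) (s := e)).
  have hC := submodule_preim (d 1%N) (submodule_zero (I 2%N)).
  have [d0 d0E] := sub_corestr hC (f := d 0%N) (fun x => exact_comp0 x (ex 0%N)).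
  have inj := @sub_incl_inj _ _ _ hC.
  exists (I 0%N), (submod hC), e, d0; split.
    split=> //.
      move=> y; have /ex[x xE] := sub_inclP (hU := hC) y; exists x.
      by apply: inj; rewrite d0E.
    move=> y; rewrite -ex0 -d0E; split=> [->|e0]; first exact: linear0.
    by apply: inj; rewrite e0 linear0.
  apply: IH; exists (fun i => I i.+1), (fun i => d i.+1), (sub_incl hC); split=> //.
    move=> y; split; first exact: sub_incl_onto.
    by case=> x <-; apply: (sub_inclP (hU := hC)).
  by move=> i ni; apply: I0.
elim: n C => [|n IH] C /=.
  move=> iC; pose Z := 'rV[S]_0 : lmodType S.
  have Z0 := row0_zero.
  exists (cons_seq C (fun=> Z)), (fun i => \0 : {linear cons_seq C (fun=> Z) i -> Z}),
    (idfun : {linear C -> C}); split.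
  - case=> // i M N g f gi; exists (\0 : {linear N -> Z}) => x; by rewrite [RHS]Z0.
  - by [].
  - by move=> y; split=> // _; exists y.
  - by move=> i y; split=> // _; exists 0; rewrite [RHS]Z0.
  - by case.
case=> I [C' [j [q [[iI ij qs ex] /IH[I' [d' [e' [iI' ei' ex0' ex' I0']]]]]]]].
exists (cons_seq I I'),
  (fun k => match k return {linear cons_seq I I' k -> I' k} with
   | 0%N => e' \o q : {linear I -> I' 0%N} | k'.+1 => d' k' end), j; split.
- by case.
- by [].
- move=> y; rewrite -ex; split=> [/= e0|y0] /=; last by rewrite y0 linear0.
  by apply: ei'; rewrite e0 linear0.
- case=> [|k] /=; last exact: ex'.
  move=> y /=; rewrite (ex0' y); split=> [[x <-]|[x <-]]; last by exists (q x).
  by have [z <-] := qs x; exists z.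
- by case=> // k nk; apply: I0'.
Qed.

(** Linearity of h is asked for on J only, so that h may be a map on J extended
    arbitrarily to S. *)
Lemma graph_extend N C (G : N * C -> Prop) (x : N) (h : S -> C) (J : S^o -> Prop) :
  is_submodule G -> is_submodule J ->
  (forall a b c : S, J b -> J c -> h (a * b + c) = a *: h b + h c) ->
  is_submodule (fun w : N * C => exists (a : S) w', [/\ G w', J a & w = w' + (a *: x, h a)]).
Proof.
move=> hG hJ hlin; split.
  exists 0, 0; split; [exact: (submodule0 hG) | exact: (submodule0 hJ) |].
  have h0 : h 0 = 0.
    by have := hlin (-1) 0 0 (submodule0 hJ) (submodule0 hJ); rewrite mulr0 addr0 scaleN1r addNr.
  by rewrite add0r scale0r h0.
move=> c _ _ [a [w [Gw Ja ->]]] [b [w' [Gw' Jb ->]]].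
exists (c * a + b), (c *: w + w'); split.
- exact: (proj2 hG).
- exact: (proj2 hJ c a b Ja Jb).
by rewrite hlin // scalerDl -scalerA scalerDr addrACA.
Qed.

(** A submodule J minimal among those strictly above J0 has a simple quotient. *)
Lemma simple_step (J0 : S^o -> Prop) : artinian_module S^o -> noetherian S^o ->
  is_submodule J0 -> ~ J0 1 ->
  exists (J : S^o -> Prop) (hJ : is_submodule J) (T : lmodType S)
    (p : {linear submod hJ -> T}),
    [/\ forall a, J0 a -> J a, exists2 a, J a & ~ J0 a,
        simple_module T /\ finitely_generated T, surjective p &
        forall y, p y = 0 <-> J0 (sub_incl hJ y)].
Proof.
move=> artS noethS hJ0 J01.
have [J [hJ [J0J [a Ja J0a]] Jmin]] := artinian_min
  (B := fun J => (forall a, J0 a -> J a) /\ exists2 a, J a & ~ J0 a)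
  artS (submodule_all (S^o : lmodType S)) (conj (fun _ _ => I) (ex_intro2 _ _ (1 : S^o) I J01)).
have hU := submodule_preim (sub_incl hJ) hJ0.
have [p [ps pE]] := quot_proj hU.
exists J, hJ, (quotmod hU), p; split=> //; first by exists a.
split; last exact: (fg_surj (f := p) ps (fg_submod hJ noethS)).
split.
  have [y yE] := sub_incl_onto hJ Ja => T0; apply: J0a.
  by rewrite -yE; apply/pE; apply: T0.
move=> W hW.
pose L b := exists2 y, W (p y) & sub_incl hJ y = b.
have hL : is_submodule L by apply: submodule_im (submodule_preim p hW).
have [[b Lb nb]|nL] := pselect (exists2 b, L b & ~ J0 b); last first.
  left=> x Wx; have [y yx] := ps x; rewrite -yx in Wx *; apply/pE.
  by apply/not_notP => n; apply: nL; exists (sub_incl hJ y) => //; exists y.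
right=> x; have [y <-] := ps x.
have [z Wz /(@sub_incl_inj _ _ _ hJ) <- //] : L (sub_incl hJ y).
apply/not_notP => nLy; apply: (Jmin L).
  split=> // [c [z _ <-]|]; first exact: sub_inclP.
  by exists (sub_incl hJ y) => //; apply: sub_inclP.
split; last by exists b.
move=> c J0c; have [z zE] := sub_incl_onto hJ (J0J c J0c); exists z => //.
suff -> : p z = 0 by apply: submodule0.
by apply/pE; rewrite zE.
Qed.

(** A maximal partial extension of f to N, given by its graph G, is total.
    Otherwise let x lie outside its domain and let J0 be the coefficients a such that
    a x lies in the domain.  There is J above J0 with J / J0 simple, so the map
    a |-> G (a x) extends from J0 to J, and G extends to the multiples a x with a in
    J. *)
Theorem injective_of_simple C : artinian_module S^o -> noetherian S^o ->
  (forall T : lmodType S, simple_module T -> finitely_generated T ->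
     (exists K, syzygy_of K T) /\ ext1_zero T C) ->
  injective_module C.
Proof.
move=> artS noethS simC M N g f gi.
pose G0 (w : N * C) := exists x, w = (g x, f x).
have hG0 : is_submodule G0.
  split; first by exists 0; rewrite !linear0.
  by move=> a _ _ [x ->] [y ->]; exists (a *: x + y); rewrite !linearP.
have [|G [hG G0G GQ Gmax]] := zorn_submodule (Q := fun w : N * C => w.1 = 0 -> w.2 = 0) hG0.
  by move=> _ [x ->] /= gx0; rewrite (gi x 0) ?linear0 // gx0 linear0.
have Gfun n c : G (n, c) -> n = 0 -> c = 0 by move=> /GQ.
have Gtot : forall n, exists c, G (n, c).
  move=> x; apply/not_notP => nx.
  pose J0 (a : S^o) := exists c, G ((a : S) *: x, c).
  have hJ0 : is_submodule J0.
    split; first by exists 0; rewrite scale0r; apply: (submodule0 hG).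
    move=> a b c [u Gu] [v Gv]; exists (a *: u + v).
    have := proj2 hG a _ _ Gu Gv; congr (G (_, _)).
    by rewrite scalerDl -scalerA.
  have J01 : ~ J0 1 by case=> c; rewrite scale1r => Gc; apply: nx; exists c.
  have [J [hJ [T [p [J0J [a Ja nJ0a] [sT fT] ps pE]]]]] := simple_step artS noethS hJ0 J01.
  have [u uE] := factor_inj (@sub_incl_inj _ _ _ hJ) (h := sub_incl hJ0)
     (fun y => sub_incl_onto hJ (J0J _ (sub_inclP y))).
  have [k kE] : exists k : {linear submod hJ0 -> C},
      forall y, G ((sub_incl hJ0 y : S) *: x, k y).
    have [] := @graph_linear _ (submod hJ0) C
      (fun w => G ((sub_incl hJ0 w.1 : S) *: x, w.2)).
    - split; first by rewrite linear0 scale0r; apply: (submodule0 hG).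
      move=> b [y c] [y' c'] /= Gy Gy'; have := proj2 hG b _ _ Gy Gy'.
      by congr (G (_, _)); rewrite /= scalerDl -scalerA.
    - by move=> y; have := sub_inclP y.
    - by move=> c; rewrite linear0 scale0r => /Gfun; apply.
    by move=> k kE; exists k.
  have [synT extT] := simC T sT fT.
  have [|||h hE] := ext1_extend (u := u) (v := p) k synT extT.
  - by move=> y y' /(congr1 (sub_incl hJ)); rewrite !uE => /sub_incl_inj.
  - exact: ps.
  - move=> y; rewrite pE; split=> [J0y|[z <-]].
      have [z zE] := sub_incl_onto hJ0 J0y; exists z.
      by apply: (@sub_incl_inj _ _ _ hJ); rewrite uE.
    by rewrite uE; apply: sub_inclP.
  (* h as a function on all of S, with the default value 0 outside J. *)
  pose hh (b : S) := if pselect (exists y, sub_incl hJ y = b) is left e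
     then h (sval (cid e)) else 0.
  have hhE y : hh (sub_incl hJ y) = h y.
    rewrite /hh; case: pselect => [e|[]]; last by exists y.
    by case: cid => z /= /sub_incl_inj ->.
  have hhlin (b c d : S) : J c -> J d -> hh (b * c + d) = b *: hh c + hh d.
    move=> /(sub_incl_onto hJ)[y <-] /(sub_incl_onto hJ)[z <-].
    rewrite [b * _](_ : _ = b *: sub_incl hJ y) // -linearP !hhE.
    exact: linearP.
  have hG' := graph_extend x hG hJ hhlin.
  have GG' w : G w -> exists (b : S) w', [/\ G w', J b & w = w' + (b *: x, hh b)].
    move=> Gw; exists 0, w; split=> //; first exact: submodule0 hJ.
    by rewrite scale0r -[X in hh X](linear0 (sub_incl hJ)) hhE linear0 addr0.
  apply: nJ0a; exists (hh a).
  apply: (Gmax _ hG' GG'); last first.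
    exists a, 0; split=> //; [exact: (submodule0 hG) | by rewrite add0r].
  move=> _ [b [[n c] [Gn Jb ->]]] /= e0.
  have bE : b *: x = - n by apply/eqP; rewrite -addr_eq0 addrC e0.
  have [z zE] : exists z, sub_incl hJ0 z = b.
    apply: sub_incl_onto; exists (- c); rewrite bE; exact: (submoduleN hG Gn).
  have Gz : G (b *: x, k z) by rewrite -zE; apply: kE.
  have hhb : hh b = k z by rewrite -hE -hhE uE zE.
  rewrite hhb; apply: (Gfun 0) => //.
  have := submoduleD hG Gn Gz; congr (G (_, _)).
  exact: e0.
have [h hE] := graph_linear hG Gtot (fun c Gc => Gfun _ _ Gc erefl).
exists h => x; apply/esym/eqP; rewrite -subr_eq0; apply/eqP.
apply: (Gfun 0) => //.
have := submoduleB hG (G0G _ (ex_intro _ x erefl)) (hE (g x)).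
by congr (G (_, _)); rewrite subrr.
Qed.

End Dimensions.

(** * Projective covers *)

Section ProjectiveCovers.
Variable S : pzRingType.
Implicit Types K M N P Q : lmodType S.

(** Take a free module F covering M and a submodule U minimal among those that still
    map onto M: the kernel of U -> M is superfluous by minimality.  U is projective:
    F -> M lifts to h : F -> U, whose restriction to U is onto, hence bijective
    because U is noetherian, and so U is a retract of F. *)
Theorem syzygy_exists M : artinian_module S^o -> noetherian S^o ->
  finitely_generated M -> exists K, finitely_generated K /\ is_syzygy K M.
Proof.
move=> artS noethS fgM; have [n [f fs]] := fg_free_cover fgM.
have fgF := @row_fg S n; have pF := @projective_row S n.
have artF := fg_artinian artS fgF; have noethF := fg_noetherian noethS fgF.
have [U [hU fU Umin]] := artinian_min
  (B := fun U => forall x, exists2 u, U u & f u = x) artF (submodule_all _)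
  (fun x => let: ex_intro u e := fs x in ex_intro2 _ _ u I e).
pose g : {linear submod hU -> M} := f \o sub_incl hU.
have gs : surjective g.
  by move=> x; have [u Uu <-] := fU x; have [y <-] := sub_incl_onto hU Uu; exists y.
have supg : superfluous (fun x => g x = 0).
  move=> W hW sW x; apply/not_notP => nWx.
  apply: (Umin (fun y => exists2 w, W w & sub_incl hU w = y)).
    split; first exact: submodule_im.
      by move=> _ [w _ <-]; apply: sub_inclP.
    exists (sub_incl hU x); first exact: sub_inclP.
    by case=> w Ww /sub_incl_inj wx; apply: nWx; rewrite -wx.
  move=> y; have [v <-] := gs y; have [w [k [Ww gk ->]]] := sW v.
  exists (sub_incl hU w); first by exists w.
  by rewrite linearD gk addr0.
have noethU := fg_noetherian noethS (fg_submod hU noethF).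
have [h hE] := pF _ _ g f gs.
pose e : {linear submod hU -> submod hU} := h \o sub_incl hU.
have ge x : g (e x) = g x by exact: (hE (sub_incl hU x)).
have es : surjective e.
  suff h1 : forall y, exists2 x, True & e x = y by move=> y; have [x _ <-] := h1 y; exists x.
  apply: supg; first exact: submodule_im (submodule_all _).
  move=> x; exists (e x), (x - e x); split; first by exists x.
    by rewrite linearB ge subrr.
  by rewrite addrC subrK.
have [e' [_ ee']] := linear_inv (conj (noetherian_surj_inj noethU es) es).
have pU : projective (submod hU : lmodType S).
  apply: (projective_retract (r := h) (s := sub_incl hU \o e')) pF => x.
  exact: ee'.
have hK := submodule_preim g (submodule_zero M).
exists (submod hK); split; first exact: fg_submod.
exists (submod hU), (sub_incl hK), g; split=> //.
  exact: sub_incl_inj.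
move=> y; split; first exact: sub_incl_onto.
by case=> x <-; apply: (sub_inclP (hU := hK)).
Qed.

Lemma surj_split P Q (h : {linear P -> Q}) : projective Q -> surjective h ->
  exists s : {linear Q -> P}, cancel s h.
Proof.
move=> pQ hs; have [s sE] := pQ _ _ h (idfun : {linear Q -> Q}) hs.
by exists s => x; rewrite sE.
Qed.

(** The image of h and the kernel of q span Q. *)
Lemma superfluous_lift P Q M (p : {linear P -> M}) (q : {linear Q -> M})
    (h : {linear P -> Q}) : surjective p ->
  superfluous (fun x => q x = 0) -> (forall x, q (h x) = p x) -> surjective h.
Proof.
move=> ps supq hE; suff h1 : forall y, exists2 x, True & h x = y.
  by move=> y; have [x _ <-] := h1 y; exists x.
apply: supq; first exact: submodule_im (submodule_all _).
move=> y; have [x px] := ps (q y).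
exists (h x), (y - h x); split; first by exists x.
  by rewrite linearB hE px subrr.
by rewrite addrC subrK.
Qed.

Lemma projective_cover_fg P M (f : {linear P -> M}) :
  projective_cover f -> finitely_generated M -> finitely_generated P.
Proof.
move=> [pP fs sup] /fg_free_cover[n [g gs]].
have [h hE] := @projective_row S n _ _ f g fs.
exact: (fg_surj (superfluous_lift gs sup hE) (@row_fg S n)).
Qed.

(** A comparison map h is onto, hence splits; the section is again a comparison map,
    so it is onto as well. *)
Lemma cover_unique P Q M (p : {linear P -> M}) (q : {linear Q -> M}) :
  projective_cover p -> projective_cover q ->
  exists2 h : {linear P -> Q}, bij_map h & forall x, q (h x) = p x.
Proof.
move=> [pP ps supp] [pQ qs supq].
have [h hE] := pP _ _ q p qs.
have hs := superfluous_lift ps supq hE.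
have [s sE] := surj_split pQ hs.
have ss : surjective s.
  by apply: (superfluous_lift qs supp) => x; rewrite -hE sE.
exists h => //; split=> // x y.
have [x' <-] := ss x; have [y' <-] := ss y.
by rewrite !sE => ->.
Qed.

Lemma syzygy_iso K K' M M' : isomorphic M M' -> is_syzygy K M -> is_syzygy K' M' ->
  isomorphic K K'.
Proof.
move=> /iso_linear[f [f' [ff' f'f]]] [P [i [p [cp ii ex]]]] [P' [i' [p' [cp' ii' ex']]]].
have cp2 : projective_cover (f \o p : {linear P -> M'}).
  case: cp => pP ps sup; split=> //.
    by move=> y; have [x xE] := ps (f' y); exists x; rewrite /= xE.
  move=> U hU sU; apply: sup => // x; have [u [k [Uu fk xE]]] := sU x.
  by exists u, k; split=> //; rewrite -[p k]ff' [f _]fk linear0.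
have [h [hi hs] hE] := cover_unique cp2 cp'.
have [g gE] : exists g : {linear K -> K'}, forall x, i' (g x) = (h \o i) x.
  apply: factor_inj => // x; apply/ex'.
  by rewrite /= hE /= (exact_comp0 _ ex) linear0.
apply: (@bij_iso _ _ _ g); split.
  by move=> x y /(congr1 i'); rewrite !gE => /hi /ii.
move=> y; have [z zE] := hs (i' y).
have [x xE] : exists x, i x = z.
  apply/ex; rewrite -[p z]ff' -[f (p z)]/((f \o p : {linear P -> M'}) z) -hE zE.
  by rewrite (exact_comp0 _ ex') linear0.
by exists x; apply: ii'; rewrite gE /= xE.
Qed.

Lemma superfluous_im P Q (i : {linear P -> Q}) (L : P -> Prop) :
  superfluous L -> superfluous (fun y => exists2 x, L x & i x = y).
Proof.
move=> sup U hU sU y.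
have Ui x : U (i x).
  apply: (sup (fun x => U (i x))); first exact: submodule_preim.
  move=> z; have [u [_ [Uu [k Lk <-] zE]]] := sU (i z).
  exists (z - k), k; split; rewrite ?subrK //.
  by rewrite linearB zE addrK.
have [u [_ [Uu [k Lk <-] ->]]] := sU y.
exact: (submoduleD hU).
Qed.

Lemma superfluous_sum P (L L' : P -> Prop) : is_submodule L ->
  superfluous L -> superfluous L' ->
  superfluous (fun x => exists u v, [/\ L u, L' v & x = u + v]).
Proof.
move=> hL sL sL' U hU sU; apply: (sL) => //; apply: sL'.
  exact: submodule_sum.
move=> x; have [u [_ [Uu [l [l' [Ll L'l' ->]]] ->]]] := sU x.
exists (u + l), l'; split=> //; last by rewrite addrA.
by exists u, l.
Qed.

Lemma syzygy_prod K K' M M' : is_syzygy K M -> is_syzygy K' M' ->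
  is_syzygy (K * K')%type (M * M')%type.
Proof.
move=> [P [i [p [[pP ps sup] ii ex]]]] [P' [i' [p' [[pP' ps' sup'] ii' ex']]]].
have [I IE] := pair_map (i \o fst : {linear (K * K')%type -> P})
  (i' \o snd : {linear (K * K')%type -> P'}).
have [p2 pE] := pair_map (p \o fst : {linear (P * P')%type -> M})
  (p' \o snd : {linear (P * P')%type -> M'}).
exists (P * P')%type, I, p2; split.
- split; first exact: projective_prod.
    move=> [x y]; have [u <-] := ps x; have [v <-] := ps' y.
    by exists (u, v); rewrite pE.
  have [a aE] := inl_map P P'; have [b bE] := inr_map P P'.
  have := superfluous_sum (submodule_im a (submodule_preim p (submodule_zero M)))
    (superfluous_im (i := a) sup) (superfluous_im (i := b) sup').
  congr superfluous; apply: funext => -[x y]; apply: propext; rewrite pE /=; split.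
    case=> _ [_ [[u pu <-] [v pv <-]]]; rewrite aE bE => -[-> ->].
    by congr (_, _); rewrite linearD ?pu ?pv ?linear0 ?addr0 // add0r.
  case=> px py; exists (a x), (b y); split; [by exists x | by exists y |].
  by rewrite aE bE; congr (_, _); rewrite ?addr0 ?add0r.
- by move=> [x y] [x' y']; rewrite !IE /= => -[/ii -> /ii' ->].
move=> [x y]; rewrite pE /=; split.
  case=> /ex[u <-] /ex'[v <-]; by exists (u, v); rewrite IE.
case=> -[u v]; rewrite IE /= => -[<- <-].
by rewrite (exact_comp0 _ ex) (exact_comp0 _ ex').
Qed.

(** A projective module is its own cover. *)
Lemma syzygy_projective K P : projective P -> is_syzygy K P -> is_zero K.
Proof.
move=> pP [Q [i [f [[pQ fs sup] ii ex]]]] x.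
have [s sE] := surj_split pP fs.
suff [y yE] : exists y, s y = i x.
  have y0 : y = 0 by rewrite -(sE y) yE (exact_comp0 _ ex).
  by apply: ii; rewrite linear0 -yE y0 linear0.
apply: (superfluous_lift (p := idfun : {linear P -> P}) _ sup sE (i x)) => y.
by exists y.
Qed.

End ProjectiveCovers.

(** * Decomposition and cancellation *)

Section Cancellation.
Variable S : pzRingType.
Implicit Types K M N P Q X Y Z : lmodType S.

Lemma submodule_im_iter M (f : {linear M -> M}) n :
  is_submodule (fun x => exists2 y, True & iter n f y = x).
Proof.
have [g gE] := iter_linear f n.
have := submodule_im g (submodule_all M).
congr is_submodule; apply: funext => x; apply: propext.
by split=> -[y _ <-]; exists y.
Qed.

(** For N large the kernel and the image of f ^ N no longer change, and Z is their
    direct sum; so one of them vanishes. *)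
Lemma fitting Z (f : {linear Z -> Z}) : artinian_module Z -> noetherian Z ->
  indecomposable Z -> bij_map f \/ exists n, forall x, iter n f x = 0.
Proof.
move=> artZ noethZ [_ indZ].
have [||n hn] := noetherian_acc (U := fun n x => iter n f x = 0) noethZ.
- exact: submodule_ker_iter.
- by move=> n x /= ->; rewrite linear0.
have [||m hm] := artZ (fun n x => exists2 y, True & iter n f y = x).
- exact: submodule_im_iter.
- by move=> k x [y _ <-]; exists (f y); rewrite // -iterSr.
pose N := (n + m)%N.
have kerN k x : iter k f x = 0 -> iter N f x = 0.
  by move=> /hn fx; rewrite /N addnC iterD fx; have [g <-] := iter_linear f m; rewrite linear0.
have imN k x : exists y, iter (N + k) f y = iter N f x.
  have [|_ h1] := hm (N + k)%N _ (iter N f x); first by rewrite /N -addnA addnCA leq_addr.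
  have [|y _ yE] := h1; last by exists y.
  by exists (iter n f x); rewrite // -iterD addnC.
have [g gE] := iter_linear f N.
have hker := submodule_preim g (submodule_zero Z).
have him := submodule_im g (submodule_all Z).
have [h hE] := copair_map (sub_incl hker) (sub_incl him).
have hb : bij_map h.
  split.
    apply: linear_inj => -[k y]; rewrite hE /= => e0.
    have [z _ zE] := sub_inclP y.
    have gk := sub_inclP k.
    have gz : g z = 0.
      rewrite gE; apply: (kerN (N + N)%N); rewrite iterD -!gE zE.
      by rewrite -[sub_incl him y](addKr (sub_incl hker k)) e0 addr0 linearN gk oppr0.
    have y0 : y = 0 by apply: (@sub_incl_inj _ _ _ him); rewrite -zE gz linear0.
    congr (_, _) => //; apply: (@sub_incl_inj _ _ _ hker).
    have e1 : sub_incl hker k + sub_incl him y = 0 := e0.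
    by move: e1; rewrite y0 (linear0 (sub_incl him)) addr0 => ->; rewrite linear0.
  move=> x; have [y yE] := imN N x; rewrite iterD -!gE in yE.
  have [u uE] : exists u, sub_incl hker u = x - g y.
    by apply: sub_incl_onto; rewrite linearB yE subrr.
  have [v vE] : exists v, sub_incl him v = g y by apply: sub_incl_onto; exists y.
  by exists (u, v); rewrite hE -[LHS]/(sub_incl hker u + sub_incl him v) uE vE subrK.
have [k0|i0] := indZ _ _ (iso_sym (bij_iso hb)); last first.
  right; exists N => x.
  have [v vE] : exists v, sub_incl him v = g x by apply: sub_incl_onto; exists x.
  by rewrite -gE -vE (i0 v) linear0.
left; have ginj x : g x = 0 -> x = 0.
  by move=> gx; have [v <-] := sub_incl_onto hker gx; rewrite (k0 v) linear0.
split.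
  by apply: linear_inj => x fx; apply: ginj; rewrite gE; apply: (kerN 1%N).
move=> x; have [y yE] := imN 1%N x; exists y.
have ginj' := linear_inj ginj.
by apply: ginj'; rewrite !gE -yE iterD.
Qed.

Lemma iter_fix M (f : {linear M -> M}) n x : iter n f x = 0 -> f x = x -> x = 0.
Proof. by move=> <- fx; elim: n => //= n <-. Qed.

Lemma nilpotent_not_inj Z (f : {linear Z -> Z}) n : ~ is_zero Z ->
  (forall x, iter n f x = 0) -> ~ injective f.
Proof.
move=> nZ fn fi; apply: nZ => x.
elim: n {fn} (fn x) => [//|n IH] /= e0; apply: IH; apply: fi.
by rewrite e0 linear0.
Qed.

(** The Schur complement of the invertible corner a. *)
Lemma gauss_elimination Z X Y (F : {linear (Z * X)%type -> (Z * Y)%type})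
    (a : {linear Z -> Z}) :
  bij_map F -> bij_map a -> (forall z, a z = (F (z, 0)).1) -> isomorphic X Y.
Proof.
move=> [Fi Fs] /linear_inv[a' [aa' a'a]] aE.
have [r rE] := inr_map Z X.
pose b := fst \o (F \o r) : {linear X -> Z}.
have Fdec z x : (F (z, x)).1 = a z + b x.
  rewrite aE /= rE -[_ + _]/((F (z, 0) + F (0, x)).1) -linearD.
  by congr (F (_, _)).1; rewrite ?addr0 ?add0r.
have [s sE] := pair_map (\- (a' \o b) : {linear X -> Z}) (idfun : {linear X -> X}).
pose g := snd \o (F \o s) : {linear X -> Y}.
have Fs1 x : (F (s x)).1 = 0 by rewrite sE Fdec /= linearN a'a addNr.
apply: (@bij_iso _ _ _ g); split.
  apply: linear_inj => x gx.
  have F0 : F (s x) = F 0.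
    by rewrite linear0 [LHS]surjective_pairing Fs1 [X in (_, X)]gx.
  by have := Fi _ _ F0; rewrite sE => -[].
move=> y; have [[z x] Fzx] := Fs (0, y).
have zE : z = - a' (b x).
  have := Fdec z x; rewrite Fzx /= => /esym/eqP; rewrite addr_eq0 => /eqP az.
  by rewrite -[z]aa' az linearN.
exists x; have -> : g x = (F (z, x)).2 by rewrite zE /g /= sE.
by rewrite Fzx.
Qed.

(** If the corner a of F is not invertible then it is nilpotent by Fitting's lemma.
    The corners of F and of its inverse satisfy a' a + b' c = 1, so b' c is
    invertible; adding a multiple of the second row of F to the first turns the
    corner a into a - 1, which is invertible, and Gauss elimination applies. *)
Lemma indecomposable_cancel Z X Y : artinian_module Z -> noetherian Z ->
  indecomposable Z -> isomorphic (Z * X)%type (Z * Y)%type -> isomorphic X Y.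
Proof.
move=> artZ noethZ indZ /iso_linear[F [F' [FF' F'F]]].
have Fb : bij_map F.
  by split; [apply: can_inj FF' | move=> y; exists (F' y)].
have [i iE] := inl_map Z X; have [i' i'E] := inl_map Z Y.
have [j' j'E] := inr_map Z Y.
pose a := fst \o (F \o i) : {linear Z -> Z}.
have aE z : a z = (F (z, 0)).1 by rewrite /a /= iE.
have [ab|[n an]] := fitting a artZ noethZ indZ; first exact: (gauss_elimination Fb ab aE).
pose c := snd \o (F \o i) : {linear Z -> Y}.
pose a' := fst \o (F' \o i') : {linear Z -> Z}.
pose b' := fst \o (F' \o j') : {linear Y -> Z}.
have sumE z : a' (a z) + b' (c z) = z.
  rewrite /a' /b' /= -[_ + _]/((F' (i' (a z)) + F' (j' (c z))).1) -linearD i'E j'E.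
  have -> : (a z, 0) + (0, c z) = F (i z) :> Z * Y.
    rewrite [RHS]surjective_pairing; congr (_, _); [exact: addr0 | exact: add0r].
  by rewrite FF' iE.
have nZ := proj1 indZ.
have injb (f : {linear Z -> Z}) : injective f -> bij_map f.
  move=> fi; have [//|[k fk]] := fitting f artZ noethZ indZ.
  by case: (nilpotent_not_inj nZ fk).
have [k a'ak] : exists k, forall x, iter k (a' \o a : {linear Z -> Z}) x = 0.
  have [[inj _]|//] := fitting (a' \o a : {linear Z -> Z}) artZ noethZ indZ.
  by case: (nilpotent_not_inj nZ an (inj_compr inj)).
pose u := b' \o c : {linear Z -> Z}.
have ub : bij_map u.
  apply/injb/linear_inj => z uz; apply: (iter_fix (a'ak z)).
  by rewrite -[RHS]sumE [b' _]uz addr0.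
have [u' [uu' u'u]] := linear_inv ub.
pose h := u' \o b' : {linear Y -> Z}.
have hc z : h (c z) = z by exact: (uu' z).
have [f fE] := pair_map ((fst \- (h \o snd)) : {linear (Z * Y)%type -> Z})
  (snd : {linear (Z * Y)%type -> Y}).
have [f' f'E] := pair_map ((fst \+ (h \o snd)) : {linear (Z * Y)%type -> Z})
  (snd : {linear (Z * Y)%type -> Y}).
(* f subtracts h from the first coordinate, and h is chosen so that h c = 1. *)
apply: (@gauss_elimination Z X Y (f \o F) (a \- idfun : {linear Z -> Z})).
- case: Fb => Fi Fs; split.
    move=> w w' /(congr1 f'); rewrite /= !f'E !fE /= !subrK -!surjective_pairing.
    exact: Fi.
  move=> w; have [v vE] := Fs (f' w); exists v.
  by rewrite /= vE f'E fE /= addrK -surjective_pairing.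
- apply/injb/linear_inj => z /eqP; rewrite /= subr_eq0 => /eqP az.
  exact: (iter_fix (an z)).
move=> z.
have -> : ((f \o F : {linear (Z * X)%type -> (Z * Y)%type}) (z, 0)).1 =
    (F (z, 0)).1 - h (F (z, 0)).2.
  by rewrite /= fE.
by rewrite -iE -[(F (i z)).2]/(c z) hc.
Qed.

(** An induction principle in place of a decomposition into indecomposables: split
    as long as possible; the embedded summands decrease strictly. *)
Lemma fg_decomposition (B : lmodType S -> Prop) :
  artinian_module S^o ->
  (forall M, is_zero M -> B M) ->
  (forall M, finitely_generated M -> indecomposable M -> B M) ->
  (forall M X Y, isomorphic M (X * Y)%type -> B X -> B Y -> B M) ->
  forall M, finitely_generated M -> B M.
Proof.
move=> artS B0 B1 B2 M fgM; have artM := fg_artinian artS fgM.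
suff H U : forall N (j : {linear N -> M}), finitely_generated N -> injective j ->
    (forall x, U x <-> exists y, j y = x) -> B N.
  by apply: (H (fun _ => True) M (idfun : {linear M -> M})) => // x; split=> // _; exists x.
elim/(well_founded_ind (artinian_wf artM)): U => U IH N j fgN ji jU.
have [N0|nN] := pselect (is_zero N); first exact: B0.
have [iN|niN] := pselect (indecomposable N); first exact: B1.
have [X [Y [XY nX nY]]] : exists X Y, [/\ isomorphic N (X * Y)%type, ~ is_zero X & ~ is_zero Y].
  apply/not_notP => h; apply: niN; split=> // X Y XY; apply/not_notP => /not_orP[nX nY].
  by apply: h; exists X, Y.
have summand X' Y' : isomorphic N (X' * Y')%type -> ~ is_zero Y' -> B X'.
  move=> /iso_linear[f [g [fg gf]]] nY'; have [i iE] := inl_map X' Y'.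
  have Gi : injective (j \o (g \o i)).
    by move=> x x' /ji /(can_inj gf); rewrite !iE => -[].
  apply: (IH (fun x => exists y, (j \o (g \o i)) y = x)) Gi _ => //; last first.
    apply: (fg_surj (f := fst \o f : {linear N -> X'})) fgN.
    by move=> x; exists (g (x, 0)); rewrite /= gf.
  split.
  - have := submodule_im (j \o (g \o i) : {linear X' -> M}) (submodule_all X').
    congr is_submodule; apply: funext => x; apply: propext.
    by split=> [[y _ <-]|[y <-]]; exists y.
  - by move=> _ [y <-]; apply/jU; exists (g (i y)).
  have [y ny] : exists y : Y', y <> 0.
    by apply/not_notP => h; apply: nY' => y; apply/not_notP => ny; apply: h; exists y.
  exists (j (g (0, y))); first by apply/jU; exists (g (0, y)).
  by case=> x /= /ji /(can_inj gf); rewrite iE => -[_ /esym].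
apply: (B2 _ _ _ XY); first exact: summand XY nY.
exact: summand (iso_trans XY (iso_prodC X Y)) nX.
Qed.

Theorem cancellation Z X Y : artinian_module S^o -> noetherian S^o ->
  finitely_generated Z -> isomorphic (Z * X)%type (Z * Y)%type -> isomorphic X Y.
Proof.
move=> artS noethS fgZ.
have : forall X Y, isomorphic (Z * X)%type (Z * Y)%type -> isomorphic X Y; last by apply.
move: Z fgZ; apply: (fg_decomposition artS) => [Z Z0|Z fgZ indZ|Z V W ZVW IV IW] X' Y'.
- by move=> /(iso_trans (iso_sym (iso_prod0 X' Z0)))/iso_trans; apply; apply: iso_prod0.
- by apply: indecomposable_cancel indZ; [apply: fg_artinian | apply: fg_noetherian].
move=> iso; apply/IW/IV.
have h X0 : isomorphic (Z * X0)%type (V * (W * X0))%type.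
  exact: iso_trans (iso_prod ZVW (iso_refl X0)) (iso_sym (iso_prodA V W X0)).
exact: iso_trans (iso_sym (h X')) (iso_trans iso (h Y')).
Qed.

End Cancellation.

(** * Infima and suprema of extended naturals *)

Section ExtendedNaturals.
Implicit Types x y z : enat.

Lemma enat_inf_Fin (P : nat -> Prop) n :
  enat_inf P = Fin n -> P n /\ forall k, P k -> (n <= k)%N.
Proof.
rewrite /enat_inf; case: pselect => // e [<-].
case: ex_minnP => m /asboolP Pm mmin; split=> // k /asboolP; exact: mmin.
Qed.

Lemma enat_inf_Infty (P : nat -> Prop) n : enat_inf P = Infty -> ~ P n.
Proof. by rewrite /enat_inf; case: pselect => // h _ Pn; apply: h; exists n. Qed.

Lemma enat_inf_le (P : nat -> Prop) n : P n -> (enat_inf P <= Fin n)%enat.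
Proof.
move=> Pn; case E: (enat_inf P) => [m|].
  by have [_ /(_ n Pn)] := enat_inf_Fin E.
by case: (enat_inf_Infty E Pn).
Qed.

Lemma enat_inf_ge (P : nat -> Prop) n : (forall k, P k -> (n <= k)%N) ->
  (Fin n <= enat_inf P)%enat.
Proof.
move=> Pn; case E: (enat_inf P) => [m|//].
by have [Pm _] := enat_inf_Fin E; apply: Pn.
Qed.

Lemma enat_le_trans y x z : (x <= y)%enat -> (y <= z)%enat -> (x <= z)%enat.
Proof. by case: x y z => [m|] [n|] [p|] //=; apply: leq_trans. Qed.

Lemma enat_sup_ub (X : enat -> Prop) x : X x -> (x <= enat_sup X)%enat.
Proof.
move=> Xx; rewrite /enat_sup; case E: (enat_inf _) => [n|]; last by case: x Xx.
by have [/(_ x Xx)] := enat_inf_Fin E.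
Qed.

Lemma enat_sup_le (X : enat -> Prop) y : (forall x, X x -> (x <= y)%enat) ->
  (enat_sup X <= y)%enat.
Proof.
case: y => [n|] h; first exact: enat_inf_le.
by case: (enat_sup X).
Qed.

End ExtendedNaturals.

(** * Reordering direct sums *)

(** Isomorphisms that only reassociate and permute summands are proved by reflection:
    two trees over the same list of modules have isomorphic sums as soon as their
    lists of leaves are permutations of each other. *)
Inductive sum_tree := Leaf of nat | Node of sum_tree & sum_tree.
Coercion Leaf : nat >-> sum_tree.

Fixpoint leaves (t : sum_tree) : seq nat :=
  match t with Leaf n => [:: n] | Node t u => leaves t ++ leaves u end.

Section SumTrees.
Variable S : pzRingType.
Variable env : seq (lmodType S).
Let Z : lmodType S := 'rV[S]_0.

Fixpoint tree_sum (t : sum_tree) : lmodType S :=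
  match t with
  | Leaf n => nth Z env n
  | Node t u => (tree_sum t * tree_sum u)%type
  end.

Let list_sum (s : seq nat) : lmodType S :=
  foldr (fun n (M : lmodType S) => (nth Z env n * M)%type : lmodType S) Z s.

Lemma list_sum_cat s t :
  isomorphic (list_sum (s ++ t)) (list_sum s * list_sum t)%type.
Proof.
elim: s => [|n s IH] /=; first exact: iso_sym (iso_prod0 _ (@row0_zero S)).
exact: iso_trans (iso_prod (iso_refl _) IH) (iso_prodA _ _ _).
Qed.

Lemma tree_list t : isomorphic (tree_sum t) (list_sum (leaves t)).
Proof.
elim: t => [n|t IHt u IHu] /=.
  exact: iso_trans (iso_sym (iso_prod0 _ (@row0_zero S))) (iso_prodC _ _).
exact: iso_trans (iso_prod IHt IHu) (iso_sym (list_sum_cat _ _)).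
Qed.

Lemma sum_AC t u : perm_eq (leaves t) (leaves u) ->
  isomorphic (tree_sum t) (tree_sum u).
Proof.
move=> tu; apply: iso_trans (tree_list t) _.
apply: iso_trans _ (iso_sym (tree_list u)).
move: tu (iso_refl (list_sum (leaves t))).
apply: (catCA_perm_ind (P := fun s => isomorphic (list_sum (leaves t)) (list_sum s))).
move=> s1 s2 s3 /iso_trans; apply.
apply: iso_trans (list_sum_cat _ _) _; apply: iso_sym.
apply: iso_trans (list_sum_cat _ _) _.
apply: iso_trans (iso_prod (iso_refl _) (list_sum_cat _ _)) _.
apply: iso_trans (iso_prodA _ _ _) _.
apply: iso_trans (iso_prod (iso_prodC _ _) (iso_refl _)) _.
apply: iso_trans (iso_sym (iso_prodA _ _ _)) _.
exact: iso_prod (iso_refl _) (iso_sym (list_sum_cat _ _)).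
Qed.

End SumTrees.

Local Notation "x :+: y" := (Node x y) (at level 50, left associativity).

(** * Minimal syzygies *)

Section Stable.
Variable A : pzRingType.
Local Notation S := A^c.
Hypothesis artS : artinian_module (S^o : lmodType S).
Hypothesis noethS : noetherian (S^o : lmodType S).
Implicit Types M N X Y P Q : fgmod A.

Definition fgmod_prod X Y : fgmod A := FgMod (fg_prod (fgmod_fg X) (fgmod_fg Y)).
Definition fgmod_zero : fgmod A := FgMod (zero_fg (@row0_zero S)).

Lemma fgmod_zero_is_zero : is_zero fgmod_zero. Proof. exact: row0_zero. Qed.
Lemma fgmod_zero_projective : projective fgmod_zero.
Proof. exact: projective_zero fgmod_zero_is_zero. Qed.

Lemma OmegaP M : is_syzygy (Omega M) M.
Proof.
rewrite /Omega; case: pselect => [e|[]]; first by case: cid.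
by have [K [fgK KM]] := syzygy_exists artS noethS (fgmod_fg M); exists (FgMod fgK).
Qed.

Lemma Omega_syzygy M : syzygy_of (Omega M) M.
Proof. exact: syzygy_syzygy_of (OmegaP M). Qed.

Lemma Omega_iso M N : isomorphic M N -> isomorphic (Omega M) (Omega N).
Proof. by move=> MN; apply: syzygy_iso MN (OmegaP M) (OmegaP N). Qed.

Lemma Omega_prod M X Y : isomorphic M (X * Y)%type ->
  isomorphic (Omega M) (Omega X * Omega Y)%type.
Proof.
by move=> MXY; apply: syzygy_iso MXY (OmegaP M) (syzygy_prod (OmegaP X) (OmegaP Y)).
Qed.

Lemma Omega_stable_retract n M N : stable_retract M N ->
  stable_retract (iter n (@Omega A) M) (iter n (@Omega A) N).
Proof.
elim: n => //= n IH /IH.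
by apply: stable_retract_syzygy; apply: Omega_syzygy.
Qed.

Lemma stable_summand_retract X Y : stable_summand X Y -> stable_retract X Y.
Proof.
move=> [Z [f [g [_ [P [a [b [pP ab]]]]]]]].
have [i iE] := inl_map X Z.
exists P, (g \o i), (fst \o f), (a \o i), (\- (fst \o b)); split=> // x /=.
have e := congr1 fst (ab (i x)); rewrite -e /= opprB addrC subrK.
by rewrite iE.
Qed.

(** Stable retracts pass to syzygies, so the bound can be tested on the minimal
    syzygies, whichever resolution witnesses it. *)
Lemma pd_le_Omega_projective n (M : lmodType S) X : stable_retract X M -> pd_le n M ->
  projective (iter n (@Omega A) X).
Proof.
elim: n M X => [|n IH] M X XM /=; first exact: stable_retract_projective.
case=> K [KM pK]; rewrite -iterS iterSr; apply: IH pK.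
exact: stable_retract_syzygy (Omega_syzygy X) KM XM.
Qed.

Lemma pd_le_Omega n M : pd_le n M <-> projective (iter n (@Omega A) M).
Proof.
split; first exact: pd_le_Omega_projective (stable_retract_refl M).
elim: n M => //= n IH M; rewrite -iterS iterSr => /IH h.
by exists (Omega M); split=> //; apply: Omega_syzygy.
Qed.

(** Ext^1(Omega^m M, C) = Ext^(m + 1)(M, C) vanishes beyond the injective
    dimension of C. *)
Lemma ext1_Omega n m C M : injdim_le n C -> (n <= m)%N ->
  ext1_zero (iter m (@Omega A) M) C.
Proof.
elim: n m C => [|n IH] m C /=; first by move=> iC _; apply: ext1_injective.
move=> [I [C' [j [q [[iI ij qs ex] idC']]]]]; case: m => //= m nm.
have [P [i [p pip]]] := Omega_syzygy (iter m (@Omega A) M).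
exact: ext1_shift_down iI ij qs ex pip (IH m C' idC' nm).
Qed.

(** Shifting Ext^(n + 1)(T, C) = 0 to Ext^1(T, C_n), where C_n is the n-th cosyzygy
    of C, reduces to injectivity tested on simple modules. *)
Lemma injdim_le_of_simple n C :
  injdim_le n.+1 C ->
  (forall T : fgmod A, simple_module T -> ext1_zero (iter n (@Omega A) T) C) ->
  injdim_le n C.
Proof.
elim: n C => [|n IH] C /=.
  move=> _ simC; apply: injective_of_simple => // T sT fgT.
  split; last exact: (simC (FgMod fgT)).
  by exists (Omega (FgMod fgT)); apply: (Omega_syzygy (FgMod fgT)).
move=> [I [C' [j [q [[iI ij qs ex] idC']]]]] simC.
exists I, C', j, q; split=> //; apply: IH => // T sT.
apply: (ext1_shift_up iI ij qs ex (Omega_syzygy _)); last exact: simC.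
by exists (Omega (Omega (iter n (@Omega A) T))); apply: Omega_syzygy.
Qed.

(** * The group K0 *)

Fixpoint K0_pos (x : K0 A) : fgmod A :=
  match x with
  | K0_class M => M
  | K0_zero => fgmod_zero
  | K0_opp x => K0_neg x
  | K0_add x y => fgmod_prod (K0_pos x) (K0_pos y)
  end
with K0_neg (x : K0 A) : fgmod A :=
  match x with
  | K0_class M => fgmod_zero
  | K0_zero => fgmod_zero
  | K0_opp x => K0_pos x
  | K0_add x y => fgmod_prod (K0_neg x) (K0_neg y)
  end.


(** Equality in K0 of two formal differences, as an isomorphism of modules up to
    projective summands.  That this is transitive is the cancellation theorem. *)
Definition K0_rel (x y : K0 A) : Prop :=
  exists P Q : fgmod A, [/\ projective P, projective Q &
    isomorphic (K0_pos x * K0_neg y * P)%type (K0_pos y * K0_neg x * Q)%type].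

Lemma fg_sum_AC (env : seq (fgmod A)) (t u : sum_tree) :
  perm_eq (leaves t) (leaves u) ->
  isomorphic (tree_sum [seq (M : lmodType S) | M <- env] t)
             (tree_sum [seq (M : lmodType S) | M <- env] u).
Proof. exact: sum_AC. Qed.

Lemma K0_rel_trans x y z : K0_rel x y -> K0_rel y z -> K0_rel x z.
Proof.
move=> [P [Q [pP pQ xy]]] [P' [Q' [pP' pQ' yz]]].
exists (fgmod_prod P P'), (fgmod_prod Q Q'); split; try exact: projective_prod.
apply: (@cancellation S (fgmod_prod (K0_pos y) (K0_neg y)) _ _ artS noethS (fgmod_fg _)).
apply: iso_trans (@fg_sum_AC [:: K0_pos x; K0_neg y; P;
    K0_pos y; K0_neg z; P']
    ((3 :+: 1) :+: ((0 :+: 4) :+: (2 :+: 5)))%N ((0 :+: 1 :+: 2) :+: (3 :+: 4 :+: 5))%N erefl) _.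
apply: iso_trans (iso_prod xy yz) _.
exact: (@fg_sum_AC [:: K0_pos y; K0_neg x; Q;
    K0_pos z; K0_neg y; Q']
    ((0 :+: 1 :+: 2) :+: (3 :+: 4 :+: 5))%N ((0 :+: 4) :+: ((3 :+: 1) :+: (2 :+: 5)))%N erefl).
Qed.

(** Induction on the derivation of the equality. *)
Lemma K0_rel_sound x y : K0_eq x y -> K0_rel x y.
Proof.
have zP := fgmod_zero_projective.
elim=> {x y}.
- by move=> x; exists fgmod_zero, fgmod_zero; split=> //; apply: iso_refl.
- by move=> x y _ [P [Q [pP pQ xy]]]; exists Q, P; split=> //; apply: iso_sym.
- by move=> x y z _ xy _; apply: K0_rel_trans.
- move=> x y _ [P [Q [pP pQ xy]]]; exists Q, P; split=> //=.
  apply: iso_trans (iso_prod (iso_prodC _ _) (iso_refl _)) _.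
  apply: iso_trans (iso_sym xy) _.
  exact: iso_prod (iso_prodC _ _) (iso_refl _).
- move=> x x' y y' _ [P [Q [pP pQ xx']]] _ [P' [Q' [pP' pQ' yy']]].
  exists (fgmod_prod P P'), (fgmod_prod Q Q'); split; try exact: projective_prod.
  apply: iso_trans (@fg_sum_AC [:: K0_pos x; K0_neg x'; P;
      K0_pos y; K0_neg y'; P']
    (((0 :+: 3) :+: (1 :+: 4)) :+: (2 :+: 5))%N ((0 :+: 1 :+: 2) :+: (3 :+: 4 :+: 5))%N erefl) _.
  apply: iso_trans (iso_prod xx' yy') _.
  exact: (@fg_sum_AC [:: K0_pos x'; K0_neg x; Q;
      K0_pos y'; K0_neg y; Q']
    ((0 :+: 1 :+: 2) :+: (3 :+: 4 :+: 5))%N (((0 :+: 3) :+: (1 :+: 4)) :+: (2 :+: 5))%N erefl).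
- move=> x y z; exists fgmod_zero, fgmod_zero; split=> //.
  exact: (@fg_sum_AC [:: K0_pos x; K0_pos y; K0_pos z;
      K0_neg x; K0_neg y; K0_neg z; fgmod_zero]
    (((0 :+: (1 :+: 2)) :+: ((3 :+: 4) :+: 5)) :+: 6)%N (((0 :+: 1) :+: 2) :+: (3 :+: (4 :+: 5)) :+: 6)%N erefl).
- move=> x y; exists fgmod_zero, fgmod_zero; split=> //.
  exact: (@fg_sum_AC [:: K0_pos x; K0_pos y;
      K0_neg x; K0_neg y; fgmod_zero]
    ((0 :+: 1) :+: (3 :+: 2) :+: 4)%N ((1 :+: 0) :+: (2 :+: 3) :+: 4)%N erefl).
- move=> x; exists fgmod_zero, fgmod_zero; split=> //.
  exact: (@fg_sum_AC [:: K0_pos x; K0_neg x; fgmod_zero]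
    ((2 :+: 0) :+: 1 :+: 2)%N (0 :+: (2 :+: 1) :+: 2)%N erefl).
- move=> x; exists fgmod_zero, fgmod_zero; split=> //.
  exact: (@fg_sum_AC [:: K0_pos x; K0_neg x; fgmod_zero]
    ((1 :+: 0) :+: 2 :+: 2)%N (2 :+: (0 :+: 1) :+: 2)%N erefl).
- move=> M N MN; exists fgmod_zero, fgmod_zero; split=> //.
  exact: iso_prod (iso_prod MN (iso_refl _)) (iso_refl _).
- move=> M M' M'' MM; exists fgmod_zero, (fgmod_prod fgmod_zero fgmod_zero); split=> //.
    exact: projective_prod.
  apply: iso_trans (iso_prod (iso_prod MM (iso_refl _)) (iso_refl _)) _.
  exact: (@fg_sum_AC [:: M'; M''; fgmod_zero]
    ((0 :+: 1) :+: (2 :+: 2) :+: 2)%N ((0 :+: 1) :+: 2 :+: (2 :+: 2))%N erefl).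
move=> P pP; exists fgmod_zero, P; split=> //.
exact: (@fg_sum_AC [:: P; fgmod_zero]
    (0 :+: 1 :+: 1)%N (1 :+: 1 :+: 0)%N erefl).
Qed.

Lemma K0_class_eq M N : K0_eq (K0_class M) (K0_class N) ->
  exists P Q : fgmod A, [/\ projective P, projective Q &
    isomorphic (M * P)%type (N * Q)%type].
Proof.
move=> /K0_rel_sound[P [Q [pP pQ MN]]].
exists (fgmod_prod fgmod_zero P), (fgmod_prod fgmod_zero Q).
split; try exact: projective_prod fgmod_zero_projective _.
exact: iso_trans (iso_prodA _ _ _) (iso_trans MN (iso_sym (iso_prodA _ _ _))).
Qed.

Lemma K0_class_zero M : K0_eq (K0_class M) (K0_zero A) -> projective M.
Proof.
move=> h; have zP := fgmod_zero_projective.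
have /K0_class_eq[P [Q [pP pQ MQ]]] : K0_eq (K0_class M) (K0_class fgmod_zero).
  exact: K0_trans h (K0_sym (K0_proj zP)).
exact: projective_fst (projective_iso (iso_sym MQ) (projective_prod zP pQ)).
Qed.

Lemma K0_Omega_congr (x y : K0 A) : K0_eq x y -> K0_eq (K0_Omega x) (K0_Omega y).
Proof.
elim=> {x y} /=.
- by move=> x; apply: K0_refl.
- by move=> x y _; apply: K0_sym.
- by move=> x y z _ xy _; apply: K0_trans.
- by move=> x y _; apply: K0_opp_congr.
- by move=> x x' y y' _ xx _; apply: K0_add_congr.
- by move=> x y z; apply: K0_addA.
- by move=> x y; apply: K0_addC.
- by move=> x; apply: K0_add0.
- by move=> x; apply: K0_addN.
- by move=> M N MN; apply/K0_iso/Omega_iso.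
- by move=> M M' M'' MM; apply/K0_sum/Omega_prod.
move=> P pP; apply/K0_proj/projective_zero.
exact: syzygy_projective pP (OmegaP P).
Qed.

Lemma iter_K0_Omega_congr n (x y : K0 A) : K0_eq x y ->
  K0_eq (iter n (@K0_Omega A) x) (iter n (@K0_Omega A) y).
Proof. by elim: n => //= n IH /IH; apply: K0_Omega_congr. Qed.

Lemma iter_K0_Omega_class n M :
  iter n (@K0_Omega A) (K0_class M) = K0_class (iter n (@Omega A) M).
Proof. by elim: n => //= n ->. Qed.

Lemma iter_K0_Omega_zero n : iter n (@K0_Omega A) (K0_zero A) = K0_zero A.
Proof. by elim: n => //= n ->. Qed.

Lemma iter_K0_Omega_sub n (x y : K0 A) : iter n (@K0_Omega A) (K0_add x (K0_opp y)) =
  K0_add (iter n (@K0_Omega A) x) (K0_opp (iter n (@K0_Omega A) y)).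
Proof. by elim: n => //= n ->. Qed.

End Stable.

#[local] Instance K0_eq_equiv A : Equivalence (@K0_eq A).
Proof. by split; [exact: K0_refl | exact: K0_sym | exact: K0_trans]. Qed.

#[local] Instance K0_add_proper A :
  Proper (@K0_eq A ==> @K0_eq A ==> @K0_eq A) (@K0_add A).
Proof. by move=> x x' xx y y' yy; apply: K0_add_congr. Qed.

#[local] Instance K0_opp_proper A : Proper (@K0_eq A ==> @K0_eq A) (@K0_opp A).
Proof. by move=> x x' xx; apply: K0_opp_congr. Qed.

#[local] Hint Resolve K0_refl : core.

Section K0Group.
Variable A : pzRingType.
Implicit Types x y z : K0 A.
Local Notation "x == y" := (K0_eq x y).
Local Notation "x + y" := (K0_add x y).
Local Notation "- x" := (K0_opp x).
Local Notation "0" := (K0_zero A).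

Lemma K0_addIr z x y : x + z == y + z -> x == y.
Proof.
have h u : u == (u + z) + - z.
  by rewrite -K0_addA (K0_addC z) K0_addN K0_addC K0_add0.
by move=> e; rewrite (h x) e -h.
Qed.

Lemma K0_sub_eq0 x y : x + - y == 0 <-> x == y.
Proof.
split=> [e|->]; last by rewrite K0_addC K0_addN.
by apply: (@K0_addIr (- y)); rewrite e K0_addC K0_addN.
Qed.

Lemma K0_opp_sub x y : - (x + - y) == y + - x.
Proof.
apply: (@K0_addIr (x + - y)); rewrite K0_addN.
rewrite K0_addA -(K0_addA y) K0_addN (K0_addC y) K0_add0.
by rewrite K0_addC K0_addN.
Qed.

Lemma K0_add_sub x x' y y' :
  (x + - y) + (x' + - y') == (x + x') + - (y + y').
Proof.
apply: (@K0_addIr (y + y')).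
rewrite -(K0_addA (x + x')) K0_addN (K0_addC _ 0) K0_add0.
rewrite (K0_addC y y') -K0_addA (K0_addA (x' + - y')) -(K0_addA x') K0_addN.
rewrite (K0_addC x' 0) K0_add0 -K0_addA (K0_addA (- y)) (K0_addC (- y)).
by rewrite -(K0_addA x') K0_addN (K0_addC x' 0) K0_add0.
Qed.

Lemma K0_repr x : x == K0_class (K0_pos x) + - K0_class (K0_neg x).
Proof.
have z0 : K0_class (fgmod_zero A) == 0 by apply: K0_proj; apply: fgmod_zero_projective.
have n0 : - 0 == 0 by rewrite -(K0_add0 (- 0)) K0_addC K0_addN.
elim: x => [M||x IH|x IHx y IHy] /=.
- by rewrite z0 n0 K0_addC K0_add0.
- by rewrite z0 n0 K0_add0.
- by rewrite {1}IH K0_opp_sub.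
have s X Y : K0_class (fgmod_prod X Y) == K0_class X + K0_class Y.
  by apply: K0_sum; apply: iso_refl.
by rewrite !s -K0_add_sub -IHx -IHy.
Qed.

End K0Group.

(** * The inequalities *)

Section Inequalities.
Variable A : pzRingType.
Local Notation S := A^c.
Hypothesis artS : artinian_module (S^o : lmodType S).
Hypothesis noethS : noetherian (S^o : lmodType S).
Implicit Types M N X Y : fgmod A.
Local Notation Om n := (iter n (@Omega A)).
Local Notation Om0 n := (iter n (@K0_Omega A)).

Lemma summand_trans (N X Y M : lmodType S) : isomorphic N (X * Y)%type ->
  is_summand N M -> is_summand X M.
Proof.
move=> NXY [L ML]; exists (Y * L)%type.
exact: iso_trans ML (iso_trans (iso_prod NXY (iso_refl L)) (iso_sym (iso_prodA _ _ _))).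
Qed.

(** M is a finite sum of indecomposable summands. *)
Lemma add_subgroup_self M : add_subgroup M (K0_class M).
Proof.
suff H (N : lmodType S) : finitely_generated N ->
    forall fgN : finitely_generated N, is_summand N M ->
      add_subgroup M (K0_class (FgMod fgN)).
  have Z0 := @row0_zero S.
  have := H M (fgmod_fg M) (fgmod_fg M); rewrite (_ : FgMod _ = M); last by case: (M).
  apply; exists 'rV[S]_0; apply: iso_sym.
  exact: iso_trans (iso_prodC _ _) (iso_prod0 _ Z0).
move: N; apply: (fg_decomposition artS) => [N N0|N _ indN|N X Y NXY HX HY] fgN sN.
- apply: add_subgroup_eq (add_subgroup_zero M).
  exact/K0_sym/K0_proj/projective_zero.
- exact: add_subgroup_class.
have [f [g [fg gf]]] := iso_linear NXY.
have fgX : finitely_generated X.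
  apply: (fg_surj (f := fst \o f : {linear N -> X})) fgN.
  by move=> x; exists (g (x, 0)); rewrite /= gf.
have fgY : finitely_generated Y.
  apply: (fg_surj (f := snd \o f : {linear N -> Y})) fgN.
  by move=> y; exists (g (0, y)); rewrite /= gf.
apply: (@add_subgroup_eq _ M (K0_add (K0_class (FgMod fgX)) (K0_class (FgMod fgY)))).
  exact/K0_sym/K0_sum.
apply: add_subgroup_add.
  by apply: HX; apply: summand_trans NXY sN.
apply: HY; apply: summand_trans sN; exact: iso_trans NXY (iso_prodC _ _).
Qed.

Lemma pd_Fin M n : pd M = Fin n <->
  projective (Om n M) /\ forall k, projective (Om k M) -> (n <= k)%N.
Proof.
have pdE k : has_projective_resolution M k <-> projective (Om k M).
  by rewrite pd_leP; apply: pd_le_Omega.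
split=> [/enat_inf_Fin[/pdE pn pmin]|[pn pmin]].
  by split=> // k /pdE; apply: pmin.
case E: (pd M) => [k|]; last by case: (enat_inf_Infty E (proj2 (pdE n) pn)).
have [/pdE pk kmin] := enat_inf_Fin E.
by congr Fin; apply/eqP; rewrite eqn_leq pmin // kmin //; apply/pdE.
Qed.

(** If phi M < pd M = n + 1, then the endomorphism is injective on the n-th image,
    which contains [Omega^n M] <> 0; but it sends that class to the class of the
    projective module Omega^(n + 1) M, which is 0. *)
Lemma pd_le_phi M : pd M <> Infty -> (pd M <= phi M)%enat.
Proof.
case E: (pd M) => [n|//] _; have /pd_Fin[pn pmin] := E.
apply: enat_inf_ge => k hk; case: ltnP => // kn.
case: n => // n in E pn pmin kn *.
have [_ inj _] := hk n kn.
suff /pmin : projective (Om n M) by rewrite ltnn.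
apply: K0_class_zero => //; apply: inj.
- by exists (K0_class M); split; [apply: add_subgroup_self | rewrite iter_K0_Omega_class].
- by exists (K0_zero A); split; [apply: add_subgroup_zero | rewrite iter_K0_Omega_zero].
exact: K0_proj.
Qed.

Lemma phi_le_psi M : (phi M <= psi M)%enat.
Proof.
rewrite /psi; case: (phi M) => //= n; case: (enat_sup _) => //= k.
exact: leq_addr.
Qed.

Lemma presentation_add (K P X Q : lmodType S) (i : {linear K -> P}) (p : {linear P -> X}) :
  presentation i p -> projective Q ->
  exists (j : {linear (K * Q)%type -> (P * Q)%type}) (q : {linear (P * Q)%type -> X}),
    presentation j q.
Proof.
move=> [pP ii ps ex] pQ.
have [j jE] := pair_map (i \o fst : {linear (K * Q)%type -> P})
  (snd : {linear (K * Q)%type -> Q}).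
exists j, (p \o fst); split; first exact: projective_prod.
- by move=> [x y] [x' y']; rewrite !jE /= => -[/ii -> ->].
- by move=> x; have [y <-] := ps x; exists (y, 0).
move=> [x y] /=; split=> [/ex[k <-]|[[k z]]]; first by exists (k, y); rewrite jE.
by rewrite jE /= => -[<- _]; apply: exact_comp0.
Qed.

Lemma presentation_iso (K K' P X : lmodType S) (f : {linear K' -> K})
    (i : {linear K -> P}) (p : {linear P -> X}) :
  bijective f -> presentation i p -> presentation (i \o f) p.
Proof.
move=> [g fg gf] [pP ii ps ex]; split=> //.
  exact: inj_comp ii (can_inj fg).
move=> y; rewrite ex; split=> [[x <-]|[x <-]]; last by exists (f x).
by exists (g x); rewrite /= gf.
Qed.

Lemma Omega_presentation X : exists (P : fgmod A) (i : {linear Omega X -> P})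
  (p : {linear P -> X}), presentation i p.
Proof.
have [P [i [p [cp ii ex]]]] := OmegaP artS noethS X.
have fgP := projective_cover_fg cp (fgmod_fg X).
by exists (FgMod fgP), i, p; case: cp.
Qed.

(** By cancellation Omega X and Omega Y agree up to projective summands; the
    vanishing of Ext makes the dual of Schanuel's lemma available, which recovers X
    and Y up to projective summands. *)
Lemma Omega_class_inj X Y : ext1_zero X S^o -> ext1_zero Y S^o ->
  K0_eq (K0_class (Omega X)) (K0_class (Omega Y)) ->
  K0_eq (K0_class X) (K0_class Y).
Proof.
move=> eX eY /(K0_class_eq artS noethS)[P [Q [pP pQ XY]]].
have [P0 [i [p pip]]] := Omega_presentation X.
have [P1 [j [q pjq]]] := Omega_presentation Y.
have [i' [p' pip']] := presentation_add pip pP.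
have [j' [q' pjq']] := presentation_add pjq pQ.
have [f fb] := XY; have pjf := presentation_iso fb pjq'.
have proj0 : projective (fgmod_prod P0 P) by case: pip'.
have proj1 : projective (fgmod_prod P1 Q) by case: pjq'.
have e := dual_schanuel pip' pjf (ext1_fg_projective (fgmod_fg (fgmod_prod P1 Q)) proj1 eX)
  (ext1_fg_projective (fgmod_fg (fgmod_prod P0 P)) proj0 eY).
have add_proj (M R : fgmod A) : projective R -> K0_eq (K0_class M) (K0_class (fgmod_prod M R)).
  move=> pR; rewrite (@K0_sum A (fgmod_prod M R) M R (iso_refl _)) (K0_proj pR).
  by rewrite K0_addC K0_add0.
rewrite (add_proj X _ proj1) (add_proj Y _ proj0).
exact: K0_iso.
Qed.

Section InjectiveDimension.
Variable d : nat.
Hypothesis idS : injdim_le d (S^o : lmodType S).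

(** An element of the m-th image killed by the endomorphism is a difference
    [Omega^m M1] - [Omega^m M2], to which Omega_class_inj applies. *)
Lemma phi_stable M m : (d <= m)%N ->
  K0_Omega_iso_on (K0_Omega_image m M) (K0_Omega_image m.+1 M).
Proof.
move=> dm; split.
- move=> x [y [My xy]]; exists y; split=> //.
  exact: (K0_Omega_congr artS noethS xy).
- move=> x y [u [_ xu]] [v [_ yv]] exy.
  rewrite xu yv; apply/K0_sub_eq0.
  have repr n : K0_eq (K0_add (Om0 n u) (K0_opp (Om0 n v)))
      (K0_add (K0_class (Om n (K0_pos (K0_add u (K0_opp v)))))
              (K0_opp (K0_class (Om n (K0_neg (K0_add u (K0_opp v))))))).
    rewrite -!iter_K0_Omega_class -!iter_K0_Omega_sub.
    exact/iter_K0_Omega_congr/K0_repr.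
  rewrite repr; apply/K0_sub_eq0/Omega_class_inj; try exact: ext1_Omega dm.
  apply/K0_sub_eq0; rewrite -(repr m.+1); apply/K0_sub_eq0 => /=.
  rewrite -(K0_Omega_congr artS noethS xu) -(K0_Omega_congr artS noethS yv).
  exact: exy.
move=> z [y [My zy]]; exists (Om0 m y); split; first by exists y.
exact: K0_sym.
Qed.

(** Let pd N = k + 1.  If n + k + 1 > d then Ext^1(Omega^k N, -) vanishes on finitely generated
    projectives, Omega^k N being a stable retract of Omega^(n + k) M.  When
    Omega^(k + 1) N is projective, the presentation of Omega^k N splits and Omega^k N
    is already projective. *)
Lemma pd_summand_bound M N n k : is_summand N (Om n M) -> pd N = Fin k ->
  (n <= d)%N -> (n + k <= d)%N.
Proof.
move=> [L NL] /pd_Fin[pk kmin] nd; case: k => [|k] in pk kmin *; first by rewrite addn0.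
rewrite leqNgt; apply/negP; rewrite addnS ltnS => dnk.
suff /kmin : projective (Om k N) by rewrite ltnn.
have [f [g [fg gf]]] := iso_linear NL.
have [i iE] := inl_map N L.
have NM : stable_retract N (Om n M).
  apply: (retract_stable (f := g \o i) (g := fst \o f)) => x.
  by rewrite /= gf iE.
have eN : ext1_zero (Om k N) S^o.
  apply: ext1_retract (Omega_stable_retract artS noethS k NM) _ _.
    by exists (Omega (Om k (Om n M))); apply: Omega_syzygy.
  rewrite -iterD. by apply: (ext1_Omega artS noethS idS); rewrite addnC.
have [P [j [p pjp]]] := Omega_presentation (Om k N).
apply: (ext1_split pjp); apply: ext1_fg_projective => //; exact: fgmod_fg.
Qed.

Lemma psi_le M : (psi M <= Fin d)%enat.
Proof.
have : (phi M <= Fin d)%enat by apply: enat_inf_le; apply: phi_stable.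
rewrite /psi.
case: (phi M) => [n|//] /= nd.
set X := (X in enat_sup X).
have : (enat_sup X <= Fin (d - n))%enat.
  apply: enat_sup_le => x [N [sN pdN ->]].
  case E: (pd N) pdN => [k|//] _ /=.
  by have := pd_summand_bound sN E nd; rewrite leq_subRL.
case: (enat_sup X) => [k|//] /= kd.
by rewrite -(subnKC nd) leq_add2l.
Qed.

End InjectiveDimension.

(** Let dell T = n <= d.  Then Omega^n T is a stable summand of Omega^(n + 1) N, so
    Omega^d T is one of Omega^(d + 1) N, and Ext^(d + 1)(T, C) is a summand of
    Ext^(d + 2)(N, C) = 0. *)
Lemma injdim_le_of_dell d (C : lmodType S) : injdim_le d.+1 C ->
  (forall T : fgmod A, simple_module T -> (dell T <= Fin d)%enat) -> injdim_le d C.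
Proof.
move=> idC dellT; apply: injdim_le_of_simple => // T sT.
have := dellT T sT; case E: (dell T) => [n|//] /= nd.
have [[N /stable_summand_retract TN] _] := enat_inf_Fin E.
have := Omega_stable_retract artS noethS (d - n) TN.
rewrite -!iterD subnK // addnS subnK // => TdN.
apply: ext1_retract TdN _ _; last exact: ext1_Omega (leqnn _).
by exists (Omega (Om d.+1 N)); apply: Omega_syzygy.
Qed.

End Inequalities.

Theorem proposition3p17 (R : comNzRingType) (A : algType R)
  (artinA : artin_algebra A) (idA : id_alg A <> Infty) :
  [/\ (findim A <= phidim A)%enat,
      (phidim A <= psidim A)%enat,
      (psidim A <= id_alg A)%enat,
      (id_alg A <= dell_alg A)%enat &
      (dell_alg A <= Dell_alg A)%enat].
Proof.
have artS := artin_algebra_artinian artinA.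
have noethS := artin_algebra_noetherian artinA.
case E: (id_alg A) idA => [d|//] _.
have [/injdim_leP idS dmin] := enat_inf_Fin E.
split.
- apply: enat_sup_le => _ [M [pdM ->]].
  apply: enat_le_trans (pd_le_phi artS noethS pdM) _.
  by apply: enat_sup_ub; exists M.
- apply: enat_sup_le => _ [M ->]; apply: enat_le_trans (phi_le_psi M) _.
  by apply: enat_sup_ub; exists M.
- by apply: enat_sup_le => _ [M ->]; apply: psi_le idS M.
- case: d => [|d] in E idS dmin *; first by case: (dell_alg A).
  rewrite -[(_ <= _)%enat]negbK; apply/negP => nle.
  have /dmin : has_injective_resolution ((A^c)^o : rmodType A) d; last by rewrite ltnn.
  apply/injdim_leP/injdim_le_of_dell => // T sT.
  apply: enat_le_trans (_ : (dell_alg A <= Fin d)%enat).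
    by apply: enat_sup_ub; exists T.
  by case: (dell_alg A) nle => //= k; rewrite -ltnNge.
by apply: enat_sup_le => _ [M [_ ->]]; apply: enat_sup_ub; exists M.
Qed.
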